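(* Let $W$ be an irreducible real (finite) reflection group with complexified reflection representation $\mathfrak{h}$, let $c$ be a conjugation-invariant complex-valued function on the set of reflections of $W$, and let $M_c=\mathbb{C}[\mathfrak{h}]$ be the polynomial representation of the rational Cherednik algebra $H_c(W)$. Let $J\subset M_c$ be an $H_c(W)$-submodule (so that $J$ is in particular an ideal of $\mathbb{C}[\mathfrak{h}]$), and let $A=M_c/J$. If $A$ is finite dimensional and the commutative algebra $A=\mathbb{C}[\mathfrak{h}]/J$ is Gorenstein, then $A=L_c$, the irreducible quotient of $M_c$; that is, $A$ is an irreducible $H_c(W)$-module.
   Context: Let $W$ be an irreducible complex reflection group with reflection representation $\mathfrak{h}$ (in the theorem $W$ is a real reflection group), $S\subset W$ the set of complex reflections, and $c:S\to\mathbb{C}$, $s\mapsto c_s$, a conjugation-invariant function. For $s\in S$ let $\alpha_s\in\mathfrak{h}^*$ be a nonzero linear function vanishing on the reflection hyperplane of $s$, and $\alpha_s^\vee\in\mathfrak{h}$ the element vanishing on the reflection hyperplane of $s$ in $\mathfrak{h}^*$, normalized by $(\alpha_s^\vee,\alpha_s)=2$. The rational Cherednik algebra $H_c(W)$ is generated by $g\in W$, $x\in\mathfrak{h}^*$, $y\in\mathfrak{h}$ (with the relations of $W$ and linear relations of $\mathfrak{h},\mathfrak{h}^*$) subject to $$gxg^{-1}=x^g,\quad gyg^{-1}=y^g,\quad [x,x']=0,\quad [y,y']=0,\quad [y,x]=(y,x)-\sum_{s\in S}c_s(y,\alpha_s)(\alpha_s^\vee,x)s .$$ The polynomial representation $M_c$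 is the $H_c(W)$-module with underlying space $\mathbb{C}[\mathfrak{h}]$ in which $W$ and $\mathfrak{h}^*$ act in the obvious way (natural action and multiplication) and $y\in\mathfrak{h}$ acts by the Dunkl operator $$\partial_y-\sum_{s\in S}\frac{2c_s}{1-\lambda_s}\frac{(\alpha_s,y)}{\alpha_s}(1-s),$$ where $\lambda_s$ is the nontrivial eigenvalue of $s$ in $\mathfrak{h}^*$ (so $\lambda_s=-1$ for real reflection groups). $L_c$ denotes the unique irreducible quotient of $M_c$. *)

(* Defs.v *)
Set Warnings "-all".
From HB Require Import structures.
From mathcomp Require Import all_boot all_order all_algebra all_fingroup.
From mathcomp Require Import all_character.
From mathcomp Require Import boolp classical_sets reals.
From mathcomp Require Import complex mpoly ring_quotient ring.

Set Implicit Arguments.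
Unset Strict Implicit.
Unset Printing Implicit Defensive.

Import Order.TTheory GRing.Theory Num.Theory.

Local Open Scope ring_scope.

Section ReflectionRepresentation.

Variables (F : fieldType) (gT : finGroupType) (W : {group gT}) (n : nat).
Variable rho : mx_representation F W n.

(* MathComp representations act on row vectors from the right.  Here h is     *)
(* 'rV[F]_n, with the left action y |-> y *m rho g^-1, and h^* is 'cV[F]_n,   *)
(* with the contragredient left action x |-> rho g *m x.                      *)
Definition pairing (y : 'rV[F]_n) (x : 'cV[F]_n) : F := (y *m x) 0 0.
Definition act_h (g : gT) (y : 'rV[F]_n) : 'rV[F]_n := y *m rho (g^-1)%g.
Definition act_hdual (g : gT) (x : 'cV[F]_n) : 'cV[F]_n := rho g *m x.

Definition reflections : {set gT} :=
  [set s in W | \rank (1%:M - rho s) == 1%N].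

Definition reflection_group : Prop :=
  mx_faithful rho /\ (<<reflections>> = W)%g.

(* The choices of alpha_s, alpha_s^vee and lambda_s; nothing is required of   *)
(* the values at elements of gT that are not reflections.                     *)
Record root_data := RootData {
  refl_root : gT -> 'cV[F]_n;
  refl_coroot : gT -> 'rV[F]_n;
  eigv : gT -> F;
  root_neq0 : forall s, s \in reflections -> refl_root s != 0;
  root_vanish : forall s, s \in reflections ->
    forall y, act_h s y = y -> pairing y (refl_root s) = 0;
  coroot_vanish : forall s, s \in reflections ->
    forall x, act_hdual s x = x -> pairing (refl_coroot s) x = 0;
  coroot_root : forall s, s \in reflections ->
    pairing (refl_coroot s) (refl_root s) = 2;
  eigv_neq1 : forall s, s \in reflections -> eigv s != 1;
  eigvP : forall s, s \in reflections ->
    exists2 x, x != 0 & act_hdual s x = eigv s *: x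
}.

Record invariant_parameter := InvariantParameter {
  parameter :> gT -> F;
  parameterJ : forall s g, s \in reflections -> g \in W ->
    parameter (s ^ g)%g = parameter s
}.

End ReflectionRepresentation.

Section CherednikModules.

Variables (F : fieldType) (gT : finGroupType) (W : {group gT}) (n : nat).
Variables (rho : mx_representation F W n) (D : root_data rho).
Variable c : invariant_parameter rho.

(* A module over H_c(W), the algebra presented by generators and relations:   *)
(* a vector space on which the generators act subject to the relations.       *)
Record cherednik_module := CherednikModule {
  carrier :> lmodType F;
  opW : gT -> carrier -> carrier;
  opX : 'cV[F]_n -> carrier -> carrier;
  opY : 'rV[F]_n -> carrier -> carrier;
  opW_linear : forall g, g \in W -> linear (opW g);
  opX_linear : forall x, linear (opX x);
  opY_linear : forall y, linear (opY y);
  opX_linear_hdual : forall v, linear (opX^~ v);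
  opY_linear_h : forall v, linear (opY^~ v);
  opW1 : forall v, opW 1%g v = v;
  opWM : forall g h, g \in W -> h \in W ->
    forall v, opW (g * h)%g v = opW g (opW h v);
  opWX : forall g, g \in W -> forall x v,
    opW g (opX x (opW (g^-1)%g v)) = opX (act_hdual rho g x) v;
  opWY : forall g, g \in W -> forall y v,
    opW g (opY y (opW (g^-1)%g v)) = opY (act_h rho g y) v;
  opXX : forall x x' v, opX x (opX x' v) - opX x' (opX x v) = 0;
  opYY : forall y y' v, opY y (opY y' v) - opY y' (opY y v) = 0;
  opYX : forall y x v,
    opY y (opX x v) - opX x (opY y v) =
    pairing y x *: v
    - \sum_(s in reflections rho)
        (c s * pairing y (refl_root D s) * pairing (refl_coroot D s) x) *: opW s v
}.

(* Subspaces are boolean predicates; by the axioms of boolp, this is no       *)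
(* restriction.                                                               *)
Definition submodule (M : cherednik_module) (N : {pred M}) : Prop :=
  [/\ submod_closed N,
      forall g, g \in W -> {in N, forall v, opW g v \in N},
      forall x, {in N, forall v, opX x v \in N}
    & forall y, {in N, forall v, opY y v \in N}].

Definition irreducible_module (M : cherednik_module) : Prop :=
  (exists v : M, v != 0) /\
  (forall N : {pred M}, submodule N -> {subset N <= pred1 0} \/ N =i predT).

Definition cherednik_hom (M N : cherednik_module) (f : M -> N) : Prop :=
  [/\ linear f,
      forall g, g \in W -> forall v, f (opW g v) = opW g (f v),
      forall x v, f (opX x v) = opX x (f v)
    & forall y v, f (opY y v) = opY y (f v)].

Definition irreducible_quotient (M L : cherednik_module) (f : M -> L) : Prop :=
  [/\ cherednik_hom f, forall v, exists u, f u = v & irreducible_module L].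

(* L, with the projection f, is the irreducible quotient of M: it is one, and *)
(* any other one is identified with it compatibly with the projections.       *)
Definition unique_irreducible_quotient (M L : cherednik_module) (f : M -> L) :=
  irreducible_quotient f /\
  forall (L' : cherednik_module) (f' : M -> L'), irreducible_quotient f' ->
    exists phi : L -> L',
      [/\ cherednik_hom phi, bijective phi & forall v, phi (f v) = f' v].

End CherednikModules.

Section PolynomialRepresentation.

Variables (F : numFieldType) (gT : finGroupType) (W : {group gT}) (n : nat).
Variables (rho : mx_representation F W n) (D : root_data rho).
Variable c : invariant_parameter rho.

Local Notation P := {mpoly F[n]}.
Local Notation S := (reflections rho).

(* F[h] is {mpoly F[n]}, where 'X_i is the i-th coordinate function on h.     *)
Definition linear_form (x : 'cV[F]_n) : P := \sum_(i < n) x i 0 *: 'X_i.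

(* (g p)(y) = p (g^-1 y), i.e., p composed with y |-> y *m rho g.             *)
Definition poly_actW (g : gT) (p : P) : P :=
  p \mPo [tuple linear_form (col i (rho g)) | i < n].

Definition directional (y : 'rV[F]_n) (p : P) : P :=
  \sum_(i < n) y 0 i *: p^`M(i).

(* The polynomial (1 - s) p / alpha_s; see divdiffP.                          *)
Definition divdiff (s : gT) (p : P) : P :=
  xget 0 [set q : P | linear_form (refl_root D s) * q = p - poly_actW s p]%classic.

Definition dunkl_def (y : 'rV[F]_n) (p : P) : P :=
  directional y p
  - \sum_(s in S) (2 * c s / (1 - eigv D s) * pairing y (refl_root D s))
                  *: divdiff s p.

(* Locked, as the unifier would otherwise unfold it; see dunklE.              *)
Fact dunkl_key : unit. Proof. exact: tt. Qed.
Definition dunkl := locked_with dunkl_key dunkl_def.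

Lemma pairing_is_linearl x : scalar ((@pairing F n)^~ x).
Proof. by move=> a y y'; rewrite /pairing mulmxDl -scalemxAl !mxE. Qed.

Lemma pairing_is_linearr y : scalar (@pairing F n y).
Proof. by move=> a x x'; rewrite /pairing mulmxDr -scalemxAr !mxE. Qed.

Lemma pairingZr a y x : @pairing F n y (a *: x) = a * pairing y x.
Proof. by rewrite /pairing -scalemxAr mxE. Qed.

Lemma pairingBr y x x' :
  @pairing F n y (x - x') = pairing y x - pairing y x'.
Proof. by rewrite /pairing mulmxBr !mxE. Qed.

Lemma pairing_act g y x : g \in W ->
  pairing (act_h rho g y) (act_hdual rho g x) = pairing y x.
Proof.
move=> gW; rewrite /pairing /act_h /act_hdual mulmxA -(mulmxA y).
by rewrite -repr_mxM ?groupV // mulVg repr_mx1 mulmx1.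
Qed.

Lemma act_hdualM g h x : g \in W -> h \in W ->
  act_hdual rho (g * h)%g x = act_hdual rho g (act_hdual rho h x).
Proof. by move=> gW hW; rewrite /act_hdual repr_mxM // mulmxA. Qed.

Lemma reflW s : s \in S -> s \in W.
Proof. by rewrite inE => /andP[]. Qed.

Lemma reflJ s g : g \in W -> ((s ^ g)%g \in S) = (s \in S).
Proof.
move=> gW; rewrite !inE groupJr //; case: (boolP (s \in W)) => //= sW.
have -> : 1%:M - rho (s ^ g)%g = rho (g^-1)%g *m (1%:M - rho s) *m rho g.
  rewrite mulmxBr mulmxBl mulmx1 -!repr_mxM ?groupM ?groupV //.
  by rewrite mulVg repr_mx1 conjgE mulgA.
by rewrite mxrankMfree ?row_free_unit ?repr_mx_unit // -mxrank_tr trmx_mul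
  mxrankMfree ?mxrank_tr // row_free_unit unitmx_tr repr_mx_unit ?groupV.
Qed.

Lemma refl_rank1 s : s \in S ->
  exists l : 'rV[F]_n, 1%:M - rho s = refl_root D s *m l.
Proof.
move=> sS; have sW := reflW sS.
have rk : \rank (1%:M - rho s) = 1%N by move: sS; rewrite inE => /andP[_ /eqP].
set M := 1%:M - rho s in rk *.
have [u [v Muv]] : exists (u : 'cV[F]_n) (v : 'rV[F]_n), M = u *m v.
  have := mulmx_base M; move: (col_base M) (row_base M); rewrite rk => u v <-.
  by exists u, v.
have : u != 0.
  by apply/eqP => u0; move: rk; rewrite Muv u0 mul0mx mxrank0.
case/cV0Pn => i ui.
have vanish y : pairing y u = 0 -> pairing y (refl_root D s) = 0.
  move=> yu; apply: root_vanish => //.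
  have yu0 : y *m u = 0.
    by apply/matrixP => a b; rewrite !ord1 [RHS]mxE -yu.
  have yM : y *m M = 0 by rewrite Muv mulmxA yu0 mul0mx.
  have ys : y = y *m rho s by apply/eqP; rewrite -subr_eq0 -yM mulmxBr mulmx1.
  by rewrite /act_h {1}ys -mulmxA -repr_mxM ?groupV // mulgV repr_mx1 mulmx1.
have prop : refl_root D s = (refl_root D s i 0 / u i 0) *: u.
  apply/matrixP => j b; rewrite ord1 {b} [RHS]mxE.
  have := vanish (delta_mx 0 j - (u j 0 / u i 0) *: delta_mx 0 i).
  rewrite /pairing !mulmxBl -!scalemxAl -!rowE !mxE.
  rewrite mulfVK // subrr => /(_ erefl) /eqP; rewrite subr_eq0 => /eqP ->.
  by ring.
set t := _ / _ in prop.
have t0 : t != 0.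
  by apply/eqP => t0; move: (root_neq0 D sS); rewrite prop t0 scale0r eqxx.
exists (t^-1 *: v).
by rewrite -scalemxAr prop -scalemxAl scalerA mulVf // scale1r.
Qed.

Lemma act_root s : s \in S -> act_hdual rho s (refl_root D s) = eigv D s *: refl_root D s.
Proof.
move=> sS; have [l Hl] := refl_rank1 sS; have [x x0 sx] := eigvP D sS.
have e1 : 1 - eigv D s != 0 by rewrite subr_eq0 eq_sym eigv_neq1.
have Ex : (1 - eigv D s) *: x = pairing l x *: refl_root D s.
  rewrite scalerBl scale1r -sx /act_hdual -{1}[x]mul1mx -mulmxBl Hl -mulmxA.
  by rewrite [l *m x]mx11_scalar mul_mx_scalar.
have lx0 : pairing l x != 0.
  apply/eqP => lx; move/eqP: Ex; rewrite lx scale0r scaler_eq0.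
  by rewrite (negPf e1) (negPf x0).
have -> : refl_root D s = ((pairing l x)^-1 * (1 - eigv D s)) *: x.
  by rewrite -scalerA Ex scalerA mulVf // scale1r.
move: sx; rewrite /act_hdual -scalemxAr => ->.
by rewrite !scalerA mulrC.
Qed.

Lemma reflE s : s \in S ->
  1%:M - rho s = ((1 - eigv D s) / 2) *: (refl_root D s *m refl_coroot D s).
Proof.
move=> sS; have [l Hl] := refl_rank1 sS.
have e1 : 1 - eigv D s != 0 by rewrite subr_eq0 eq_sym eigv_neq1.
have r0 := root_neq0 D sS.
have sE x : x - act_hdual rho s x = pairing l x *: refl_root D s.
  rewrite /act_hdual -{1}[x]mul1mx -mulmxBl Hl -mulmxA.
  by rewrite [l *m x]mx11_scalar mul_mx_scalar.
have lr : pairing l (refl_root D s) = 1 - eigv D s.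
  have := sE (refl_root D s); rewrite act_root // -{1}[refl_root D s]scale1r -scalerBl.
  by move/eqP; rewrite -subr_eq0 -scalerBl scaler_eq0 (negPf r0) orbF subr_eq0
    => /eqP.
suff lE : l = ((1 - eigv D s) / 2) *: refl_coroot D s by rewrite Hl lE scalemxAr.
have two0 : (2 : F) != 0 by rewrite pnatr_eq0.
have key x : pairing (refl_coroot D s) x = 2 / (1 - eigv D s) * pairing l x.
  set z := x - (pairing l x / (1 - eigv D s)) *: refl_root D s.
  have sz : act_hdual rho s z = z.
    apply/eqP; rewrite eq_sym -subr_eq0 sE pairingBr pairingZr lr.
    by rewrite mulfVK // subrr scale0r.
  have := coroot_vanish D sS sz; rewrite pairingBr pairingZr coroot_root //.
  by move/eqP; rewrite subr_eq0 => /eqP ->; ring.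
apply/matrixP => a j; rewrite ord1 [RHS]mxE.
have := key (delta_mx j 0); rewrite /pairing -!colE !mxE => ->.
by field; rewrite e1.
Qed.

Lemma refl_act_hdual s x : s \in S ->
  x - act_hdual rho s x =
  ((1 - eigv D s) / 2 * pairing (refl_coroot D s) x) *: refl_root D s.
Proof.
move=> sS; rewrite /act_hdual -{1}[x]mul1mx -mulmxBl reflE // -scalemxAl.
by rewrite -mulmxA [refl_coroot D s *m x]mx11_scalar mul_mx_scalar scalerA.
Qed.

Lemma refl_act_h s : s \in S ->
  exists w, forall y, y - act_h rho s y = pairing y (refl_root D s) *: w.
Proof.
move=> sS; have sW := reflW sS; have [l Hl] := refl_rank1 sS.
exists (- (l *m rho (s^-1)%g)) => y.
have -> : y - act_h rho s y = - (y *m (1%:M - rho s) *m rho (s^-1)%g).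
  rewrite mulmxBr mulmx1 mulmxBl opprB -(mulmxA y) -repr_mxM ?groupV //.
  by rewrite mulgV repr_mx1 mulmx1.
rewrite Hl mulmxA [y *m refl_root D s]mx11_scalar mul_scalar_mx -scalemxAl.
by rewrite scalerN.
Qed.

Lemma reflJ_root s g : s \in S -> g \in W ->
  exists2 k, k != 0 &
    act_hdual rho g (refl_root D s) = k *: refl_root D (s ^ g^-1)%g.
Proof.
move=> sS gW; have sW := reflW sS.
have s'S : (s ^ g^-1)%g \in S by rewrite reflJ ?groupV.
have e1 : 1 - eigv D s != 0 by rewrite subr_eq0 eq_sym eigv_neq1.
set z := act_hdual rho g (refl_root D s).
have z0 : z != 0.
  apply/eqP => z0; move/negP: (root_neq0 D sS); apply.
  have : act_hdual rho (g^-1)%g z = 0 by rewrite z0 /act_hdual mulmx0.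
  rewrite -act_hdualM ?groupV // mulVg /act_hdual repr_mx1 mul1mx => ->.
  by rewrite eqxx.
have sz : act_hdual rho (s ^ g^-1)%g z = eigv D s *: z.
  rewrite -act_hdualM ?groupJ ?groupV //.
  have -> : (s ^ g^-1 * g = g * s)%g by rewrite conjgE invgK !mulgA mulgKV.
  by rewrite act_hdualM // act_root // /act_hdual -scalemxAr.
have := refl_act_hdual z s'S; rewrite sz -{1}[z]scale1r -scalerBl => Ez.
exists ((1 - eigv D s)^-1 * ((1 - eigv D (s ^ g^-1)%g) / 2 *
     pairing (refl_coroot D (s ^ g^-1)%g) z)); last first.
  by rewrite -scalerA -Ez scalerA mulVf // scale1r.
apply/eqP => k0; move/negP: z0; apply.
by rewrite -[z]scale1r -(mulVf e1) -scalerA Ez scalerA k0 scale0r.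
Qed.

Lemma reflJ_eigv s g : s \in S -> g \in W -> eigv D (s ^ g^-1)%g = eigv D s.
Proof.
move=> sS gW; have sW := reflW sS.
have s'S : (s ^ g^-1)%g \in S by rewrite reflJ ?groupV.
have [k k0 Ek] := reflJ_root sS gW.
have r0 := root_neq0 D s'S.
have : act_hdual rho (s ^ g^-1)%g (act_hdual rho g (refl_root D s)) =
    eigv D s *: act_hdual rho g (refl_root D s).
  rewrite -act_hdualM ?groupJ ?groupV //.
  have -> : (s ^ g^-1 * g = g * s)%g by rewrite conjgE invgK !mulgA mulgKV.
  by rewrite act_hdualM // act_root // /act_hdual -scalemxAr.
rewrite Ek /act_hdual -scalemxAr; rewrite -/(act_hdual _ _ _) act_root //.
rewrite !scalerA => /eqP; rewrite -subr_eq0 -scalerBl scaler_eq0 (negPf r0).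
by rewrite orbF mulrC -mulrBl mulf_eq0 (negPf k0) orbF subr_eq0 => /eqP.
Qed.

Lemma linear_form_is_linear : linear linear_form.
Proof.
move=> a x y; rewrite /linear_form scaler_sumr -big_split; apply: eq_bigr => i _.
by rewrite !mxE scalerDl scalerA.
Qed.

HB.instance Definition _ :=
  GRing.isLinear.Build F 'cV[F]_n P *:%R linear_form linear_form_is_linear.

Lemma linear_form_eq0 x : (linear_form x == 0) = (x == 0).
Proof.
apply/eqP/eqP => [x0|->]; last exact: linear0.
apply/matrixP => i j; rewrite ord1 mxE.
have := congr1 (mcoeff U_(i)%MM) x0; rewrite mcoeff0 => <-.
rewrite /linear_form raddf_sum /= (bigD1 i) //= mcoeffZ mcoeffX eqxx mulr1.
rewrite big1 ?addr0 // => k ki.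
by rewrite mcoeffZ mcoeffX eq_mnm1 (negPf ki) mulr0.
Qed.

Lemma poly_gen_ind (Q : P -> Prop) :
  Q 1 -> (forall p q, Q p -> Q q -> Q (p + q)) ->
  (forall a p, Q p -> Q (a *: p)) -> (forall i p, Q p -> Q ('X_i * p)) ->
  forall p, Q p.
Proof.
move=> Q1 QD QZ QX; elim/mpolyind => [|a m p _ _ Qp].
  by rewrite -(scale0r (1 : P)); exact: QZ.
apply: QD Qp; apply: QZ; rewrite mpolyXE_id.
elim/big_rec: _ => // i q _ Qq; elim: (m i) => [|k IH]; first by rewrite mul1r.
by rewrite exprS -mulrA; apply: QX.
Qed.

Lemma poly_actW_is_linear g : linear (poly_actW g).
Proof. by move=> a p q; rewrite /poly_actW comp_mpolyD comp_mpolyZ. Qed.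

HB.instance Definition _ g :=
  GRing.isLinear.Build F P P *:%R (poly_actW g) (poly_actW_is_linear g).

Lemma poly_actWM g p q : poly_actW g (p * q) = poly_actW g p * poly_actW g q.
Proof. exact: rmorphM. Qed.

Lemma poly_actW_one g : poly_actW g 1 = 1.
Proof. exact: comp_mpoly1. Qed.

Lemma poly_actWX g i : poly_actW g 'X_i = linear_form (col i (rho g)).
Proof.
by rewrite /poly_actW comp_mpolyXU -tnth_nth tnth_mktuple.
Qed.

Lemma linear_formX i : 'X_i = linear_form (delta_mx i 0).
Proof.
rewrite /linear_form (bigD1 i) //= mxE !eqxx scale1r big1 ?addr0 // => k ki.
by rewrite mxE (negPf ki) scale0r.
Qed.

Lemma poly_actW_linear_form g x :
  poly_actW g (linear_form x) = linear_form (act_hdual rho g x).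
Proof.
rewrite {1}/linear_form linear_sum /=.
have -> : act_hdual rho g x = \sum_i x i 0 *: col i (rho g).
  apply/matrixP => i j; rewrite ord1 !mxE summxE; apply: eq_bigr => k _.
  by rewrite !mxE mulrC.
by rewrite linear_sum; apply: eq_bigr => i _; rewrite !linearZ /= poly_actWX.
Qed.

Lemma poly_actWMg g h p : g \in W -> h \in W ->
  poly_actW (g * h)%g p = poly_actW g (poly_actW h p).
Proof.
move=> gW hW; elim/poly_gen_ind: p => [|p q IHp IHq|a p IH|i p IH].
- by rewrite !poly_actW_one.
- by rewrite !linearD /= IHp IHq.
- by rewrite !linearZ /= IH.
rewrite !poly_actWM IH linear_formX !poly_actW_linear_form.
by rewrite act_hdualM.
Qed.

Lemma poly_actW1g p : poly_actW 1%g p = p.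
Proof.
elim/poly_gen_ind: p => [|p q IHp IHq|a p IH|i p IH].
- by rewrite !poly_actW_one.
- by rewrite !linearD /= IHp IHq.
- by rewrite !linearZ /= IH.
rewrite poly_actWM IH linear_formX poly_actW_linear_form.
by rewrite /act_hdual repr_mx1 mul1mx.
Qed.

Lemma poly_actWC g a : poly_actW g a%:MP = a%:MP.
Proof. exact: comp_mpolyC. Qed.

#[local] Opaque linear_form poly_actW.

Lemma directional_is_linear y : linear (directional y).
Proof.
move=> a p q; rewrite /directional scaler_sumr -big_split; apply: eq_bigr => i _.
by rewrite linearP scalerDr !scalerA /= mulrC.
Qed.

HB.instance Definition _ y :=
  GRing.isLinear.Build F P P *:%R (directional y) (directional_is_linear y).

Lemma directionalM y p q :
  directional y (p * q) = directional y p * q + p * directional y q.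
Proof.
rewrite /directional mulr_suml mulr_sumr -big_split; apply: eq_bigr => i _.
by rewrite mderivM scalerDr /= -scalerAl -scalerAr.
Qed.

Lemma directional_linear_form y x :
  directional y (linear_form x) = (pairing y x)%:MP.
Proof.
rewrite /directional /pairing mxE rmorph_sum; apply: eq_bigr => i _ /=.
have -> : (linear_form x)^`M(i) = (x i 0)%:MP.
  rewrite raddf_sum (bigD1 i) //= big1 ?addr0 => [|k ki].
    by rewrite mderivZ mderivX mnm1E eqxx scale1r -{1}[U_(i)%MM]add0m addmK mpolyX0 alg_mpolyC.
  by rewrite mderivZ mderivX mnm1E (negPf ki) scale0r scaler0.
by rewrite -mul_mpolyC -rmorphM.
Qed.

Lemma directional1 y : directional y 1 = 0.
Proof.
rewrite /directional big1 // => i _.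
by rewrite -mpolyC1 mderivC scaler0.
Qed.

Lemma divdiff_exists s p : s \in S ->
  exists q, linear_form (refl_root D s) * q = p - poly_actW s p.
Proof.
move=> sS; elim/poly_gen_ind: p => [|p q [p' Hp] [q' Hq]|a p [p' Hp]|i p [p' Hp]].
- by exists 0; rewrite mulr0 poly_actW_one subrr.
- by exists (p' + q'); rewrite mulrDr Hp Hq linearD /= opprD addrACA.
- by exists (a *: p'); rewrite -scalerAr Hp linearZ /= scalerBr.
set k := (1 - eigv D s) / 2 * pairing (refl_coroot D s) (delta_mx i 0).
exists ('X_i * p' + k *: poly_actW s p).
rewrite mulrDr mulrCA Hp poly_actWM -scalerAr scalerAl.
have -> : k *: linear_form (refl_root D s) = 'X_i - poly_actW s 'X_i.
  by rewrite linear_formX poly_actW_linear_form -linearB refl_act_hdual // linearZ.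
by rewrite mulrBr mulrBl addrA subrK.
Qed.

Lemma divdiffP s p : s \in S ->
  linear_form (refl_root D s) * divdiff s p = p - poly_actW s p.
Proof.
move=> sS; have [q Hq] := divdiff_exists p sS.
by rewrite /divdiff; case: xgetP => [q' _|/(_ q)].
Qed.

Lemma divdiff_uniq s p q : s \in S ->
  linear_form (refl_root D s) * q = p - poly_actW s p -> divdiff s p = q.
Proof.
move=> sS; rewrite -divdiffP // => H; apply: (@mulfI _ (linear_form (refl_root D s))) => //.
by rewrite linear_form_eq0 root_neq0.
Qed.

#[local] Opaque divdiff.

Lemma divdiff_is_linear s : s \in S -> linear (divdiff s).
Proof.
move=> sS a p q; apply: divdiff_uniq => //.
rewrite linearP /= opprD addrACA -scalerBr -!divdiffP // mulrDr.
by rewrite scalerAr.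
Qed.

Lemma divdiff_act s g p : s \in S -> g \in W -> forall y,
  pairing y (refl_root D s) *: poly_actW g (divdiff s p) =
  pairing (act_h rho g y) (refl_root D (s ^ g^-1)%g)
    *: divdiff (s ^ g^-1)%g (poly_actW g p).
Proof.
move=> sS gW y; have sW := reflW sS.
have s'S : (s ^ g^-1)%g \in S by rewrite reflJ ?groupV.
have [k k0 Ek] := reflJ_root sS gW.
rewrite -(pairing_act y _ gW) Ek pairingZr mulrC -scalerA; congr (_ *: _).
apply/esym/divdiff_uniq => //.
have EL : k *: linear_form (refl_root D (s ^ g^-1)%g) =
    poly_actW g (linear_form (refl_root D s)).
  by rewrite poly_actW_linear_form Ek linearZ.
rewrite -scalerAr scalerAl EL -poly_actWM.
rewrite divdiffP // linearB /= -(poly_actWMg p gW sW).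
rewrite -(poly_actWMg p (reflW s'S) gW).
by rewrite conjgE invgK !mulgA mulgKV.
Qed.

Lemma divdiff_linear_form s x p : s \in S ->
  divdiff s (linear_form x * p) = linear_form x * divdiff s p
    + ((1 - eigv D s) / 2 * pairing (refl_coroot D s) x) *: poly_actW s p.
Proof.
move=> sS; apply: divdiff_uniq => //.
rewrite mulrDr mulrCA divdiffP // poly_actWM -scalerAr scalerAl -linearZ /=.
rewrite -refl_act_hdual // linearB poly_actW_linear_form.
by rewrite mulrBr mulrBl addrA subrK.
Qed.

Lemma divdiff1 s : s \in S -> divdiff s 1 = 0.
Proof. by move=> sS; apply: divdiff_uniq; rewrite // mulr0 poly_actW_one subrr. Qed.

Lemma dunklE y p : dunkl y p =
  directional y p
  - \sum_(s in S) (2 * c s / (1 - eigv D s) * pairing y (refl_root D s))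
                  *: divdiff s p.
Proof. by rewrite /dunkl unlock. Qed.

Lemma dunkl_is_linear y : linear (dunkl y).
Proof.
move=> a p q; rewrite !dunklE linearP /= scalerBr addrACA -opprD.
rewrite [a *: \sum_(s in S) _]scaler_sumr.
congr (_ - _); rewrite -big_split; apply: eq_bigr => s sS /=.
by rewrite divdiff_is_linear // scalerDr !scalerA mulrC.
Qed.

Lemma dunkl0 y : dunkl y 0 = 0.
Proof.
have := dunkl_is_linear y (-1) 0 0.
by rewrite scaler0 addr0 scaleN1r addNr.
Qed.

Lemma dunklD y p q : dunkl y (p + q) = dunkl y p + dunkl y q.
Proof. by rewrite -[p]scale1r dunkl_is_linear !scale1r. Qed.

Lemma dunklZ y a p : dunkl y (a *: p) = a *: dunkl y p.
Proof. by rewrite -[a *: p]addr0 dunkl_is_linear dunkl0 addr0. Qed.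

Lemma dunklB y p q : dunkl y (p - q) = dunkl y p - dunkl y q.
Proof. by rewrite -scaleN1r dunklD dunklZ scaleN1r. Qed.

Lemma dunkl_is_linear_h p : linear (dunkl^~ p).
Proof.
move=> a y z; rewrite !dunklE.
have -> : directional (a *: y + z) p = a *: directional y p + directional z p.
  rewrite /directional scaler_sumr -big_split; apply: eq_bigr => i _ /=.
  by rewrite !mxE scalerDl scalerA.
rewrite scalerBr addrACA -opprD.
rewrite [a *: \sum_(s in S) _]scaler_sumr.
congr (_ - _); rewrite -big_split; apply: eq_bigr => s _ /=.
by rewrite pairing_is_linearl mulrDr scalerDl scalerA mulrCA.
Qed.

Lemma directional_act g y p :
  g \in W -> poly_actW g (directional y p) =
             directional (act_h rho g y) (poly_actW g p).
Proof.
move=> gW; elim/poly_gen_ind: p => [|p q IHp IHq|a p IH|i p IH].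
- by rewrite directional1 poly_actW_one directional1 linear0.
- by rewrite !linearD /= IHp IHq.
- by rewrite !linearZ /= IH.
rewrite linear_formX poly_actWM !directionalM linearD /= !poly_actWM IH.
rewrite poly_actW_linear_form !directional_linear_form pairing_act //.
by rewrite poly_actWC.
Qed.

Lemma dunkl_act g y p : g \in W ->
  poly_actW g (dunkl y p) = dunkl (act_h rho g y) (poly_actW g p).
Proof.
move=> gW; rewrite !dunklE linearB /= directional_act //; congr (_ - _).
rewrite linear_sum [RHS](reindex_inj (conjg_inj (g^-1)%g)) /=.
apply: eq_big => [s|s sS]; first by rewrite reflJ ?groupV.
rewrite linearZ /= -[LHS]scalerA divdiff_act // scalerA.
by rewrite parameterJ ?groupV // reflJ_eigv.
Qed.

Lemma dunkl_linear_form y x p :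
  dunkl y (linear_form x * p) - linear_form x * dunkl y p =
  pairing y x *: p
  - \sum_(s in S)
      (c s * pairing y (refl_root D s) * pairing (refl_coroot D s) x) *: poly_actW s p.
Proof.
pose k s := c s * pairing y (refl_root D s) * pairing (refl_coroot D s) x.
pose b s := 2 * c s / (1 - eigv D s) * pairing y (refl_root D s).
have E : \sum_(s in S) b s *: divdiff s (linear_form x * p) =
    linear_form x * (\sum_(s in S) b s *: divdiff s p)
    + \sum_(s in S) k s *: poly_actW s p.
  rewrite mulr_sumr -big_split; apply: eq_bigr => s sS /=.
  rewrite divdiff_linear_form // scalerDr -scalerAr scalerA; congr (_ + _ *: _).
  by rewrite /b /k; field; rewrite subr_eq0 eq_sym eigv_neq1.
have dE q : dunkl y q = directional y q - \sum_(s in S) b s *: divdiff s q.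
  by rewrite dunklE.
have -> : dunkl y (linear_form x * p) = directional y (linear_form x * p)
    - (linear_form x * (\sum_(s in S) b s *: divdiff s p)
       + \sum_(s in S) k s *: poly_actW s p).
  by rewrite -E dunklE.
rewrite dE directionalM directional_linear_form mul_mpolyC.
by ring.
Qed.

Lemma dunkl1 y : dunkl y 1 = 0.
Proof.
rewrite dunklE directional1 big1 ?subr0 // => s sS.
by rewrite divdiff1 ?scaler0.
Qed.

Lemma dunklC y z p : dunkl y (dunkl z p) = dunkl z (dunkl y p).
Proof.
elim/poly_gen_ind: p => [|p q IHp IHq|a p IH|i p IH].
- by rewrite !dunkl1 !dunkl0.
- rewrite (dunklD z p q) (dunklD y p q) (dunklD y (dunkl z p) (dunkl z q)).
  rewrite (dunklD z (dunkl y p) (dunkl y q)).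
  by rewrite IHp IHq.
- by rewrite (dunklZ z a p) (dunklZ y a p) (dunklZ y a) (dunklZ z a) IH.
rewrite linear_formX; set x := delta_mx _ _.
pose k (y : 'rV[F]_n) s :=
  c s * pairing y (refl_root D s) * pairing (refl_coroot D s) x.
have mulD u q : dunkl u (linear_form x * q) = linear_form x * dunkl u q +
    (pairing u x *: q - \sum_(s in S) k u s *: poly_actW s q).
  by rewrite -dunkl_linear_form addrC subrK.
pose A s u v := k u s *: poly_actW s (dunkl v p)
                + k v s *: dunkl u (poly_actW s p).
have expand u v : dunkl u (dunkl v (linear_form x * p)) =
    linear_form x * dunkl u (dunkl v p) + pairing u x *: dunkl v p +
    pairing v x *: dunkl u p - \sum_(s in S) A s u v.
  have -> : \sum_(s in S) A s u v =
      \sum_(s in S) k u s *: poly_actW s (dunkl v p)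
      + dunkl u (\sum_(s in S) k v s *: poly_actW s p).
    rewrite (big_morph (dunkl u) (dunklD u) (dunkl0 u)) -big_split; apply: eq_bigr => s _ /=.
    by rewrite dunklZ.
  rewrite mulD dunklD mulD dunklB dunklZ.
  set a1 := linear_form x * _; set a2 := _ *: dunkl v p; set a3 := _ *: _.
  by set a4 := \sum_(s in S) _; set a5 := dunkl u _; ring.
have cross s : s \in S -> A s y z = A s z y.
  move=> sS; have sW := reflW sS; have [w Hw] := refl_act_h sS.
  have act u : poly_actW s (dunkl u p) =
      dunkl u (poly_actW s p) - pairing u (refl_root D s) *: dunkl w (poly_actW s p).
    rewrite dunkl_act //.
    have -> : act_h rho s u = - pairing u (refl_root D s) *: w + u.
      by rewrite scaleNr -Hw opprB subrK.
    by rewrite dunkl_is_linear_h scaleNr addrC.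
  rewrite /A !act !scalerBr !scalerA.
  have -> : k y s * pairing z (refl_root D s) = k z s * pairing y (refl_root D s).
    by rewrite /k; ring.
  by rewrite addrAC [RHS]addrAC [k y s *: _ + _]addrC.
rewrite !expand (eq_bigr _ cross).
rewrite IH.
set a1 := linear_form x * _; set a2 := _ *: dunkl z p; set a3 := _ *: _.
by set a4 := \sum_(s in S) _; ring.
Qed.

Lemma dunkl_comm y z p : dunkl y (dunkl z p) - dunkl z (dunkl y p) = 0.
Proof. by rewrite dunklC subrr. Qed.

Definition poly_opX (x : 'cV[F]_n) (p : P) : P := linear_form x * p.

Lemma poly_opX_linear x : linear (poly_opX x).
Proof. by move=> a p q; rewrite /poly_opX mulrDr -scalerAr. Qed.

Lemma poly_opX_linear_hdual p : linear (poly_opX^~ p).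
Proof. by move=> a x y; rewrite /poly_opX linearP mulrDl -scalerAl. Qed.

Lemma poly_opWX g : g \in W -> forall x p,
  poly_actW g (poly_opX x (poly_actW (g^-1)%g p)) =
  poly_opX (act_hdual rho g x) p.
Proof.
move=> gW x p; rewrite /poly_opX poly_actWM poly_actW_linear_form.
by rewrite -poly_actWMg ?groupV // mulgV poly_actW1g.
Qed.

Lemma poly_opWY g : g \in W -> forall y p,
  poly_actW g (dunkl y (poly_actW (g^-1)%g p)) = dunkl (act_h rho g y) p.
Proof.
move=> gW y p; rewrite dunkl_act //.
by rewrite -poly_actWMg ?groupV // mulgV poly_actW1g.
Qed.

Lemma poly_opXX x x' p :
  poly_opX x (poly_opX x' p) - poly_opX x' (poly_opX x p) = 0.
Proof. by rewrite /poly_opX mulrCA subrr. Qed.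

Definition polynomial_module : cherednik_module D c :=
  CherednikModule (fun g _ => poly_actW_is_linear g) poly_opX_linear
    dunkl_is_linear poly_opX_linear_hdual dunkl_is_linear_h poly_actW1g
    (fun g h gW hW p => poly_actWMg p gW hW) poly_opWX poly_opWY
    poly_opXX dunkl_comm dunkl_linear_form.

(* J as an ideal of F[h]; 1 \notin J amounts to J <> F[h], i.e., F[h]/J <> 0,  *)
(* which is part of F[h]/J being Gorenstein.                                  *)
Record proper_submodule := ProperSubmodule {
  ideal_of :> {pred P};
  ideal_ofP : submodule (M := polynomial_module) ideal_of;
  ideal_of_proper : 1 \notin ideal_of
}.

Lemma ideal_of_idealr (J : proper_submodule) : idealr_closed (ideal_of J).
Proof.
have [[J0 JZD] _ JX _] := ideal_ofP J.
have JD p q : p \in ideal_of J -> q \in ideal_of J -> p + q \in ideal_of J.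
  by move=> pJ qJ; rewrite -[p]scale1r; apply: JZD.
split=> [//||a p q pJ qJ]; first exact: ideal_of_proper.
apply: (JD) => //; elim/poly_gen_ind: a => [|a b aJ bJ|k a aJ|i a aJ].
- by rewrite mul1r.
- by rewrite mulrDl; apply: JD.
- by rewrite -scalerAl -[_ *: _]addr0; apply: JZD.
by rewrite -mulrA linear_formX; apply: JX.
Qed.

HB.instance Definition _ (J : proper_submodule) :=
  isIdealr.Build P (ideal_of J) (ideal_of_idealr J).

Definition poly_quotient (J : proper_submodule) : Type := {ideal_quot (ideal_of J)}.

HB.instance Definition _ J := GRing.ComNzRing.on (poly_quotient J).

Section Quotient.

Variable J : proper_submodule.
Local Notation A := (poly_quotient J).

Definition quotient_proj (p : P) : A := \pi_({ideal_quot (ideal_of J)})%qT p.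

Definition quotient_scale (a : F) (u : A) : A := quotient_proj a%:MP * u.

(* An operator on F[h] preserving J, on the quotient.                         *)
Definition quotient_op (f : P -> P) (u : A) : A := quotient_proj (f (generic_quotient.repr u)).

Lemma quotient_projD p q :
  quotient_proj (p + q) = quotient_proj p + quotient_proj q.
Proof. exact: (rmorphD \pi_({ideal_quot (ideal_of J)})%qT). Qed.

Lemma quotient_projM p q :
  quotient_proj (p * q) = quotient_proj p * quotient_proj q.
Proof. exact: (rmorphM \pi_({ideal_quot (ideal_of J)})%qT). Qed.

Lemma quotient_proj1 : quotient_proj 1 = 1.
Proof. exact: (rmorph1 \pi_({ideal_quot (ideal_of J)})%qT). Qed.

Lemma quotient_projK (u : A) : quotient_proj (generic_quotient.repr u) = u.
Proof. exact: generic_quotient.reprK. Qed.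

Lemma quotient_projP p q :
  quotient_proj p = quotient_proj q <-> p - q \in ideal_of J.
Proof.
have E := Quotient.idealrBE (ideal_of J) p q.
by split=> [/eqP H|H]; [rewrite E|apply/eqP; rewrite E in H].
Qed.

Lemma quotient_scaleA a b u :
  quotient_scale a (quotient_scale b u) = quotient_scale (a * b) u.
Proof. by rewrite /quotient_scale mulrA -quotient_projM rmorphM. Qed.

Lemma quotient_scale1 : left_id 1 quotient_scale.
Proof. by move=> u; rewrite /quotient_scale mpolyC1 quotient_proj1 mul1r. Qed.

Lemma quotient_scaleDr : right_distributive quotient_scale +%R.
Proof. by move=> a u v; rewrite /quotient_scale mulrDr. Qed.

Lemma quotient_scaleDl u : {morph quotient_scale^~ u : a b / a + b}.
Proof.
by move=> a b; rewrite /quotient_scale mpolyCD quotient_projD mulrDl.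
Qed.

HB.instance Definition _ := GRing.Zmodule_isLmodule.Build F A
  quotient_scaleA quotient_scale1 quotient_scaleDr quotient_scaleDl.

Lemma quotient_scaleAl (a : F) (u v : A) : a *: (u * v) = (a *: u) * v.
Proof. exact: mulrA. Qed.

HB.instance Definition _ :=
  GRing.Lmodule_isLalgebra.Build F A quotient_scaleAl.
HB.instance Definition _ := GRing.Lalgebra_isComAlgebra.Build F A.

Lemma quotient_projZ a p : quotient_proj (a *: p) = a *: quotient_proj p.
Proof. by rewrite -mul_mpolyC quotient_projM. Qed.

Lemma quotient_opE (f : P -> P) : linear f ->
  {in ideal_of J, forall p, f p \in ideal_of J} ->
  forall p, quotient_op f (quotient_proj p) = quotient_proj (f p).
Proof.
move=> fl fJ p; apply/quotient_projP.
have := quotient_projK (quotient_proj p); move/quotient_projP => /fJ.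
by rewrite addrC -scaleN1r fl scaleN1r addrC.
Qed.

Lemma quotient_op_linear (f : P -> P) : linear f ->
  {in ideal_of J, forall p, f p \in ideal_of J} -> linear (quotient_op f).
Proof.
move=> fl fJ a u v; rewrite -[u]quotient_projK -[v]quotient_projK.
rewrite -quotient_projZ -quotient_projD !quotient_opE //.
by rewrite fl quotient_projD quotient_projZ.
Qed.

Definition quotient_opW (g : gT) : A -> A := quotient_op (poly_actW g).
Definition quotient_opX (x : 'cV[F]_n) : A -> A := quotient_op (poly_opX x).
Definition quotient_opY (y : 'rV[F]_n) : A -> A := quotient_op (dunkl y).

Lemma quotient_opWE g p : g \in W ->
  quotient_opW g (quotient_proj p) = quotient_proj (poly_actW g p).
Proof.
have [_ JW _ _] := ideal_ofP J => gW.
by apply: quotient_opE; [exact: poly_actW_is_linear|exact: JW].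
Qed.

Lemma quotient_opXE x p :
  quotient_opX x (quotient_proj p) = quotient_proj (poly_opX x p).
Proof.
have [_ _ JX _] := ideal_ofP J.
by apply: quotient_opE; [exact: poly_opX_linear|exact: JX].
Qed.

Lemma quotient_opYE y p :
  quotient_opY y (quotient_proj p) = quotient_proj (dunkl y p).
Proof.
have [_ _ _ JY] := ideal_ofP J.
by apply: quotient_opE; [exact: dunkl_is_linear|exact: JY].
Qed.

Lemma quotient_projB p q :
  quotient_proj (p - q) = quotient_proj p - quotient_proj q.
Proof. exact: (rmorphB \pi_({ideal_quot (ideal_of J)})%qT). Qed.

Lemma quotient_proj0 : quotient_proj 0 = 0.
Proof. exact: (rmorph0 \pi_({ideal_quot (ideal_of J)})%qT). Qed.

Lemma quotient_opW_linear g : g \in W -> linear (quotient_opW g).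
Proof.
have [_ JW _ _] := ideal_ofP J => gW.
by apply: quotient_op_linear; [exact: poly_actW_is_linear|exact: JW].
Qed.

Lemma quotient_opX_linear x : linear (quotient_opX x).
Proof.
have [_ _ JX _] := ideal_ofP J.
by apply: quotient_op_linear; [exact: poly_opX_linear|exact: JX].
Qed.

Lemma quotient_opY_linear y : linear (quotient_opY y).
Proof.
have [_ _ _ JY] := ideal_ofP J.
by apply: quotient_op_linear; [exact: dunkl_is_linear|exact: JY].
Qed.

Lemma quotient_opX_linear_hdual u : linear (quotient_opX^~ u).
Proof.
move=> a x y; rewrite -[u]quotient_projK !quotient_opXE.
by rewrite poly_opX_linear_hdual quotient_projD quotient_projZ.
Qed.

Lemma quotient_opY_linear_h u : linear (quotient_opY^~ u).
Proof.
move=> a x y; rewrite -[u]quotient_projK !quotient_opYE.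
by rewrite dunkl_is_linear_h quotient_projD quotient_projZ.
Qed.

Lemma quotient_opW1 u : quotient_opW 1%g u = u.
Proof.
by rewrite -[u]quotient_projK quotient_opWE // poly_actW1g.
Qed.

Lemma quotient_opWM g h : g \in W -> h \in W -> forall u,
  quotient_opW (g * h)%g u = quotient_opW g (quotient_opW h u).
Proof.
move=> gW hW u; rewrite -[u]quotient_projK !quotient_opWE ?groupM //.
by rewrite poly_actWMg.
Qed.

Lemma quotient_opWX g : g \in W -> forall x u,
  quotient_opW g (quotient_opX x (quotient_opW (g^-1)%g u)) =
  quotient_opX (act_hdual rho g x) u.
Proof.
move=> gW x u; rewrite -[u]quotient_projK quotient_opWE ?groupV //.
by rewrite !quotient_opXE quotient_opWE // poly_opWX.
Qed.

Lemma quotient_opWY g : g \in W -> forall y u,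
  quotient_opW g (quotient_opY y (quotient_opW (g^-1)%g u)) =
  quotient_opY (act_h rho g y) u.
Proof.
move=> gW y u; rewrite -[u]quotient_projK quotient_opWE ?groupV //.
by rewrite !quotient_opYE quotient_opWE // poly_opWY.
Qed.

Lemma quotient_opXX x x' u :
  quotient_opX x (quotient_opX x' u) - quotient_opX x' (quotient_opX x u) = 0.
Proof.
rewrite -[u]quotient_projK !quotient_opXE -quotient_projB poly_opXX.
exact: quotient_proj0.
Qed.

Lemma quotient_opYY y y' u :
  quotient_opY y (quotient_opY y' u) - quotient_opY y' (quotient_opY y u) = 0.
Proof.
rewrite -[u]quotient_projK !quotient_opYE -quotient_projB dunkl_comm.
exact: quotient_proj0.
Qed.

Lemma quotient_opYX y x u :
  quotient_opY y (quotient_opX x u) - quotient_opX x (quotient_opY y u) =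
  pairing y x *: u
  - \sum_(s in S)
      (c s * pairing y (refl_root D s) * pairing (refl_coroot D s) x) *: quotient_opW s u.
Proof.
rewrite -[u]quotient_projK !(quotient_opXE, quotient_opYE) -quotient_projB.
rewrite dunkl_linear_form quotient_projB quotient_projZ; congr (_ - _).
rewrite (big_morph quotient_proj quotient_projD quotient_proj0).
apply: eq_bigr => s sS.
by rewrite quotient_projZ quotient_opWE // reflW.
Qed.

Definition quotient_module : cherednik_module D c :=
  CherednikModule quotient_opW_linear quotient_opX_linear quotient_opY_linear
    quotient_opX_linear_hdual quotient_opY_linear_h quotient_opW1 quotient_opWM
    quotient_opWX quotient_opWY quotient_opXX quotient_opYY quotient_opYX.

End Quotient.

End PolynomialRepresentation.

Section FiniteDimensionalAlgebras.

Variable F : fieldType.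

Definition finite_dimensional (V : lmodType F) : Prop :=
  exists (m : nat) (e : 'I_m -> V),
    forall v, exists a : 'I_m -> F, v = \sum_(i < m) a i *: e i.

(* A finite-dimensional (nonzero) commutative F-algebra A is Gorenstein if A  *)
(* is isomorphic, as an A-module, to its canonical module Hom_F(A, F), where  *)
(* (a . phi)(b) = phi (a * b).  Here Phi a : A -> F is the image of a under   *)
(* such an isomorphism.                                                       *)
Definition gorenstein (A : comAlgType F) : Prop :=
  exists Phi : A -> A -> F,
    [/\ forall a, scalar (Phi a),
        forall b, scalar (Phi^~ b),
        forall a a' b, Phi (a * a') b = Phi a' (a * b),
        forall a a', Phi a =1 Phi a' -> a = a'
      & forall phi : A -> F, scalar phi -> exists a, Phi a =1 phi].

End FiniteDimensionalAlgebras.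

(* Main.v *)
Require Import Defs.
Set Warnings "-all".
From mathcomp Require Import all_boot all_order all_algebra all_fingroup.
From mathcomp Require Import all_character.
From mathcomp Require Import boolp reals complex mpoly ring.

(** The idea is to compare, in [A = F[h]/J], the singular vectors (those killed
    by all Dunkl operators) with the socle (the vectors killed by all linear
    functions), by means of a Fourier transform.

    W being real, averaging over it produces a positive definite form, hence
    over the complex numbers an invariant nondegenerate symmetric form, an
    invariant quadratic polynomial q on h and, dually, a Dunkl Laplacian.
    Let [e] be multiplication by q and [f] the Laplacian, each with a factor
    1/2.  The commutators of [e] with Dunkl operators and of [f] with linear
    functions exchange h and h^* ([quadric_opY], [laplaceX]), while [e] commutes
    with linear functions and [f] with Dunkl operators.  On A both [e] and [f]
    are nilpotent: [f] because Dunkl operators lower degrees, [e] because J is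
    homogeneous, the Euler field being the action of an element of the algebra
    ([eulerE]).  So [T = exp e \o exp f \o exp e] makes sense; it is an
    injective linear map, and it conjugates Dunkl operators into
    multiplications by linear functions ([fourier_swap]).  Therefore T embeds
    the singular vectors into the socle.

    If A is Gorenstein, its socle is a line ([gorenstein_socle]), so the
    singular vectors are the multiples of 1.  A nonzero submodule of A contains
    a nonzero singular vector, namely one represented by a polynomial of
    least degree; hence it contains 1, hence is A.

    That A is then the unique irreducible quotient holds because submodules of
    F[h] are homogeneous: a proper one consists of polynomials without constant
    term, so two proper submodules never add up to F[h]. *)

Set Implicit Arguments.
Unset Strict Implicit.
Unset Printing Implicit Defensive.

Import Order.TTheory GRing.Theory Num.Theory.

Local Open Scope ring_scope.

(** * Linear functions and subspaces *)

Section LinearFunctions.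

Variables (F : pzRingType) (U V : lmodType F) (f : U -> V).
Hypothesis fl : linear f.

Lemma linear_fun0 : f 0 = 0.
Proof. by have := fl (-1) 0 0; rewrite scaler0 addr0 scaleN1r addNr. Qed.

Lemma linear_funD : {morph f : u v / u + v}.
Proof. by move=> u v; rewrite -[u]scale1r fl !scale1r. Qed.

Lemma linear_funZ a : {morph f : u / a *: u}.
Proof. by move=> u; rewrite -[a *: u]addr0 fl linear_fun0 // addr0. Qed.

Lemma linear_funB : {morph f : u v / u - v}.
Proof. by move=> u v; rewrite -scaleN1r linear_funD linear_funZ scaleN1r. Qed.

Lemma linear_fun_sum (I : finType) (Q : pred I) (u : I -> U) :
  f (\sum_(i | Q i) u i) = \sum_(i | Q i) f (u i).
Proof. by rewrite (big_morph f linear_funD linear_fun0). Qed.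

End LinearFunctions.

Section Subspaces.

Variables (F : pzRingType) (V : lmodType F) (N : {pred V}).
Hypothesis NS : submod_closed N.

Lemma submod_closed_scale a u : u \in N -> a *: u \in N.
Proof. by have [N0 NZD] := NS => uN; rewrite -[_ *: _]addr0 NZD. Qed.

Lemma submod_closed_add u v : u \in N -> v \in N -> u + v \in N.
Proof. by have [_ NZD] := NS => uN vN; rewrite -[u]scale1r NZD. Qed.

Lemma submod_closed_sub u v : u \in N -> v \in N -> u - v \in N.
Proof. by have [_ NZD] := NS => uN vN; rewrite addrC -scaleN1r NZD. Qed.

Lemma submod_closed_sum (I : finType) (Q : pred I) (f : I -> V) :
  (forall i, Q i -> f i \in N) -> \sum_(i | Q i) f i \in N.
Proof.
have [N0 _] := NS => fN; apply: (big_ind (fun u => u \in N)) => //.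
exact: submod_closed_add.
Qed.

End Subspaces.

Lemma finite_dimensional_dependent (F : fieldType) (V : lmodType F)
    (v : nat -> V) : finite_dimensional V ->
  exists m (k : 'I_m -> F), (exists i, k i != 0) /\ \sum_i k i *: v i = 0.
Proof.
move=> [m [e spanE]].
have /choice[f Hf] : forall i : 'I_m.+1, exists f : 'I_m -> F, v i = \sum_j f j *: e j.
  by move=> i; apply: spanE.
pose Q : 'M[F]_(m.+1, m) := \matrix_(i, j) f i j.
have : kermx Q != 0.
  by rewrite -mxrank_eq0 mxrank_ker -lt0n subn_gt0 ltnS rank_leq_col.
case/rowV0Pn => k /sub_kermxP kQ /rV0Pn[i ki].
exists m.+1, (fun i => k 0 i); split; first by exists i.
under eq_bigr => j _ do rewrite Hf scaler_sumr.
rewrite exchange_big big1 //= => j _.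
under eq_bigr => l _ do rewrite scalerA.
rewrite -scaler_suml; have /matrixP/(_ 0 j) := kQ.
rewrite !mxE; under eq_bigr => l _ do rewrite mxE.
by move=> ->; rewrite scale0r.
Qed.

(** Applying [f - mu m] to a sum of eigenvectors removes its last term and
    rescales the others by nonzero factors. *)
Lemma eigen_components (F : numFieldType) (V : lmodType F) (N : {pred V})
    (f : V -> V) m (v : nat -> V) (mu : nat -> F) :
  submod_closed N -> linear f -> {in N, forall u, f u \in N} ->
  injective mu -> (forall k, f (v k) = mu k *: v k) ->
  \sum_(k < m) v k \in N -> forall k, (k < m)%N -> v k \in N.
Proof.
move=> NS fl fN muI; elim: m v => [//|m IH] v fv sN.
have low k : (k < m)%N -> v k \in N.
  move=> km; have d0 : mu k - mu m != 0.
    by rewrite subr_eq0; apply: contraTneq km => /muI ->; rewrite ltnn.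
  rewrite -[v k]scale1r -(mulVf d0) -scalerA submod_closed_scale //.
  apply: (IH (fun j => (mu j - mu m) *: v j)) => // [j|].
    by rewrite (linear_funZ fl) fv !scalerA mulrC.
  have := submod_closed_sub NS (fN _ sN) (submod_closed_scale NS (mu m) sN).
  rewrite linear_fun_sum // scaler_sumr -sumrB big_ord_recr /= fv subrr addr0.
  by under eq_bigr => j _ do rewrite fv -scalerBl.
move=> k; rewrite ltnS leq_eqVlt => /predU1P[->|]; last exact: low.
have -> : v m = \sum_(j < m.+1) v j - \sum_(j < m) v j.
  by rewrite big_ord_recr /= [RHS]addrC addKr.
by apply: submod_closed_sub => //; apply: submod_closed_sum => // j _; apply: low.
Qed.

(** * Exponentials of nilpotent operators *)

Section Exponential.

Variables (F : numFieldType) (V : lmodType F).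
Implicit Types f g h : V -> V.

(** The exponential of an operator whose N-th iterate vanishes. *)
Definition expo (N : nat) f (v : V) : V :=
  \sum_(k < N) (k`!%:R)^-1 *: iter k f v.

Lemma iter_linear f k : linear f -> linear (iter k f).
Proof. by move=> fl; elim: k => [//|k IH] a u v; rewrite !iterS IH fl. Qed.

Lemma expo_linear N f : linear f -> linear (expo N f).
Proof.
move=> fl a u v; rewrite /expo scaler_sumr -big_split; apply: eq_bigr => k _ /=.
by rewrite iter_linear // scalerDr !scalerA mulrC.
Qed.

(** The commutation rules say that [ad f] maps g to h and h to 0, so
    [exp f \o g \o exp (- f) = exp (ad f) g = g + h]. *)
Lemma expo_commute N f g h : linear f -> linear g -> linear h ->
  (forall v, f (g v) = g (f v) + h v) -> (forall v, f (h v) = h (f v)) ->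
  (forall v, iter N f v = 0) ->
  forall v, expo N f (g v) = g (expo N f v) + h (expo N f v).
Proof.
move=> fl gl hl fg fh fN v.
have step k u : iter k f (g u) = g (iter k f u) + k%:R *: h (iter k.-1 f u).
  elim: k u => [|k IH] u; first by rewrite /= scale0r addr0.
  rewrite iterS IH (linear_funD fl) fg (linear_funZ fl) fh /= -addrA; congr (_ + _).
  case: k {IH} => [|k /=]; first by rewrite scale0r addr0 scale1r.
  by rewrite -[in RHS]natr1 scalerDl scale1r addrC.
(* Differentiating the exponential series lowers its length by one. *)
have expoS u : expo N f u = expo N.+1 f u.
  by rewrite /expo big_ord_recr /= fN scaler0 addr0.
rewrite {1}expoS /expo; under eq_bigr => k _ do rewrite step scalerDr scalerA.
rewrite big_split /=; congr (_ + _).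
  rewrite big_ord_recr /= fN (linear_fun0 gl) scaler0 addr0 linear_fun_sum //.
  by apply: eq_bigr => k _; rewrite (linear_funZ gl).
rewrite big_ord_recl mulr0 scale0r add0r linear_fun_sum //.
apply: eq_bigr => k _; rewrite (linear_funZ hl) /= /bump add1n.
by rewrite factS natrM invfM mulrAC mulVf ?mul1r // pnatr_eq0.
Qed.

(** If [iter k.+1 f] kills v then [iter k f] does not distinguish v from its
    exponential; descending on k, v is killed by [iter 0 f]. *)
Lemma expo_inj N f : linear f -> (forall v, iter N f v = 0) ->
  forall v, expo N f v = 0 -> v = 0.
Proof.
move=> fl fN v ev.
suff H k : (k <= N)%N -> iter (N - k) f v = 0 by rewrite -(H N) // subnn.
elim: k => [|k IH] kN; first by rewrite subn0.
have {IH}IH := IH (ltnW kN).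
have iter0 j : iter j f 0 = 0 by elim: j => //= j ->; rewrite linear_fun0.
have high j : (N - k <= j)%N -> iter j f v = 0.
  by move=> le; rewrite -(subnK le) iterD IH iter0.
have := congr1 (iter (N - k.+1) f) ev.
have il := iter_linear (N - k.+1) fl.
rewrite iter0 /expo linear_fun_sum //.
have N0 : (0 < N)%N by apply: leq_trans kN.
rewrite (bigD1 (Ordinal N0)) //= invr1 scale1r big1 ?addr0 // => i i0.
rewrite (linear_funZ il) -iterD high ?scaler0 //.
have : (0 < i)%N by rewrite lt0n; apply: contra i0 => /eqP i0; apply/eqP/val_inj.
by move: kN; case: (nat_of_ord i) => // j kN _;
  rewrite addnS -addSn -subSn // subSS leq_addr.
Qed.

End Exponential.

(** * The Fourier transform *)

Section FourierTransform.
Variables (F : numFieldType) (V : lmodType F).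
Variables (NE NF : nat) (e f x y : V -> V).
Hypotheses (el : linear e) (fl : linear f) (xl : linear x) (yl : linear y).
Hypotheses (eN : forall v, iter NE e v = 0) (fN : forall v, iter NF f v = 0).
Hypothesis ey : forall v, y (e v) = e (y v) + x v.
Hypothesis ex : forall v, e (x v) = x (e v).
Hypothesis fx : forall v, f (x v) = x (f v) + y v.
Hypothesis fy : forall v, f (y v) = y (f v).

(** With [E, F] the exponentials of [e, f]: [E y = (y - x) E], [E x = x E],
    [F x = (x + y) F] and [F y = y F].  So [E F E y = - x E F E], as for the
    Weyl element of SL2 on the span of x and y. *)
Lemma fourier_swap v : y v = 0 -> x (expo NE e (expo NF f (expo NE e v))) = 0.
Proof.
move=> yv.
have e0 N g : linear g -> expo N g 0 = 0 by move=> /(expo_linear N)/linear_fun0.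
have xN : linear (fun v => - x v) by move=> a u w; rewrite xl opprD scalerN.
have l0 : linear (fun _ : V => 0 : V) by move=> a u w; rewrite scaler0 addr0.
have eX u : expo NE e (x u) = x (expo NE e u).
  rewrite (expo_commute el xl l0 _ _ eN) ?addr0 // => w; first by rewrite addr0.
  exact: linear_fun0.
have eY u : expo NE e (y u) = y (expo NE e u) - x (expo NE e u).
  apply: (expo_commute el yl xN) => // w; first by rewrite ey addrK.
  by rewrite -scaleN1r linear_funZ // ex scaleN1r.
have fX u : expo NF f (x u) = x (expo NF f u) + y (expo NF f u).
  exact: (expo_commute fl xl yl).
have fY u : expo NF f (y u) = y (expo NF f u).
  rewrite (expo_commute fl yl l0 _ _ fN) ?addr0 // => w; first by rewrite addr0.
  exact: linear_fun0.
set u := expo NE e v.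
have yu : y u = x u by apply/eqP; rewrite -subr_eq0 -eY yv e0.
have xw : x (expo NF f u) = 0.
  apply: (addIr (y (expo NF f u))).
  by rewrite -fX -yu fY add0r.
by rewrite -eX xw e0.
Qed.

End FourierTransform.

(** * Gorenstein algebras *)

(** Under an isomorphism of A with its dual, a socle element becomes a linear
    form vanishing on the ideal generated by the [x i]; as this ideal and 1 span
    A, such a form is determined by its value at 1. *)
Lemma gorenstein_socle (F : fieldType) (A : comAlgType F) (I : finType)
    (x : I -> A) (u v : A) :
  gorenstein A ->
  (forall b, exists k r, b = k *: 1 + \sum_i x i * r i) ->
  u != 0 -> (forall i, x i * u = 0) -> (forall i, x i * v = 0) ->
  exists k, v = k *: u.
Proof.
move=> [Phi [Plin PlinA PM Pinj _]] gen u0 xu xv.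
have P0 b : Phi 0 b = 0.
  by have := PlinA b (-1) 0 0; rewrite scaler0 addr0 mulN1r addNr.
have Psoc w : (forall i, x i * w = 0) -> forall k r,
    Phi w (k *: 1 + \sum_i x i * r i) = k * Phi w 1.
  move=> xw k r; rewrite Plin.
  have -> : Phi w (\sum_i x i * r i) = Phi (\sum_i (x i * w) * r i) 1.
    rewrite -[\sum_i x i * r i]mulr1 -PM; congr (Phi _ _).
    by rewrite mulr_suml; apply: eq_bigr => i _; rewrite mulrAC.
  by rewrite big1 ?P0 ?addr0 // => i _; rewrite xw mul0r.
have Pu : Phi u 1 != 0.
  apply: contra u0 => /eqP Pu; apply/eqP/Pinj => b.
  by have [k [r ->]] := gen b; rewrite Psoc // Pu mulr0 P0.
exists (Phi v 1 / Phi u 1); apply/Pinj => b.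
rewrite -[_ *: u]addr0 PlinA P0 addr0.
by have [k [r ->]] := gen b; rewrite !Psoc // mulrCA divfK.
Qed.

(** * Degrees and the Euler field on polynomials *)

Section Polynomials.
Variables (F : numFieldType) (gT : finGroupType) (W : {group gT}) (n : nat).
Variables (rho : mx_representation F W n) (D : root_data rho).
Variable c : invariant_parameter rho.

Local Notation P := {mpoly F[n]}.
Local Notation S := (reflections rho).

Lemma linear_form_homog (x : 'cV[F]_n) : linear_form x \is 1.-homog.
Proof.
rewrite /linear_form rpred_sum // => i _.
by rewrite rpredZ // dhomogX /= mdeg1.
Qed.

Lemma msize_linear_form (x : 'cV[F]_n) : x != 0 -> msize (linear_form x) = 2%N.
Proof.
rewrite -linear_form_eq0 => x0; have H := linear_form_homog x.
by rewrite (mpolySpred _ x0) -(dhomog_uniq x0 H (dhomog_msize H)).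
Qed.

Lemma msize_mderiv i (p : P) : (msize p^`M(i) <= (msize p).-1)%N.
Proof.
rewrite msizeE; apply/bigmax_leqP_seq => m; rewrite mcoeff_msupp mcoeff_mderiv => mp _.
have : (m + U_(i))%MM \in msupp p.
  by rewrite mcoeff_msupp; apply: contraNneq mp => ->; rewrite mul0rn.
by move/msize_mdeg_lt; rewrite mdegD mdeg1 addn1; case: (msize p).
Qed.

Lemma homog_msize_le d (p : P) : p \is d.-homog -> (msize p <= d.+1)%N.
Proof.
move=> /dhomogP H; rewrite msizeE; apply/bigmax_leqP_seq => m mp _.
by have /= -> := H m mp.
Qed.

Lemma msize_poly_actW g (p : P) : (msize (poly_actW rho g p) <= msize p)%N.
Proof.
rewrite /poly_actW comp_mpolyEX; apply: (leq_trans (msize_sum _ _ _)).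
apply/bigmax_leqP_seq => m /msize_mdeg_lt mp _.
apply: leq_trans (msizeZ_le _ _) _; apply: leq_trans mp; apply: homog_msize_le.
rewrite comp_mpolyX mdegE.
elim/big_rec2: _ => [|i d q _ qd]; first exact: dhomog1.
apply: dhomogM => //; rewrite tnth_mktuple -[X in X.-homog]mul1n.
exact/dhomogMn/linear_form_homog.
Qed.

Lemma msize_divdiff s (p : P) : s \in S -> (msize (divdiff D s p) <= (msize p).-1)%N.
Proof.
move=> sS; have [->|d0] := eqVneq (divdiff D s p) 0; first by rewrite msize0.
have l0 : linear_form (refl_root D s) != 0 by rewrite linear_form_eq0 root_neq0.
have : (msize (p - poly_actW rho s p) <= msize p)%N.
  by rewrite (leq_trans (msizeD_le _ _)) // geq_max leqnn msizeN msize_poly_actW.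
rewrite -(divdiffP D) // msizeM // msize_linear_form ?root_neq0 //.
by rewrite add2n /=; case: (msize p).
Qed.

(** Both the derivative and the divided difference lower the degree. *)
Lemma msize_dunkl y (p : P) : (msize (dunkl D c y p) <= (msize p).-1)%N.
Proof.
rewrite dunklE (leq_trans (msizeD_le _ _)) // geq_max msizeN; apply/andP; split.
  apply: (leq_trans (msize_sum _ _ _)); apply/bigmax_leqP => i _.
  by rewrite (leq_trans (msizeZ_le _ _)) ?msize_mderiv.
apply: (leq_trans (msize_sum _ _ _)); apply/bigmax_leqP => i iS.
by rewrite (leq_trans (msizeZ_le _ _)) ?msize_divdiff.
Qed.

Definition euler (p : P) : P := \sum_(i < n) 'X_i * p^`M(i).

Lemma euler_is_linear : linear euler.
Proof.
move=> a p q; rewrite /euler scaler_sumr -big_split; apply: eq_bigr => i _ /=.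
by rewrite mderivD mderivZ mulrDr scalerAr.
Qed.

Lemma eulerM p q : euler (p * q) = euler p * q + p * euler q.
Proof.
rewrite /euler mulr_suml mulr_sumr -big_split; apply: eq_bigr => i _ /=.
by rewrite mderivM; ring.
Qed.

Lemma eulerX (m : 'X_{1..n}) : euler 'X_[m] = (mdeg m)%:R *: ('X_[m] : P).
Proof.
rewrite /euler mdegE natr_sum scaler_suml; apply: eq_bigr => i _.
rewrite mderivX -scalerAr -mpolyXD; have [->|mi] := eqVneq (m i) 0%N.
  by rewrite !scale0r.
by rewrite addmC submK // lep1mP.
Qed.

Lemma euler_homog d (p : P) : p \is d.-homog -> euler p = d%:R *: p.
Proof.
move=> /dhomogP H; rewrite [p in LHS]mpolyE [p in RHS]mpolyE scaler_sumr.
rewrite (big_morph euler (linear_funD euler_is_linear) (linear_fun0 euler_is_linear)).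
rewrite !big_seq; apply: eq_bigr => m mp.
by rewrite (linear_funZ euler_is_linear) eulerX /= -(H m mp) !scalerA mulrC.
Qed.

Lemma directional_delta i (p : P) : directional (delta_mx 0 i) p = p^`M(i).
Proof.
rewrite /directional (bigD1 i) //= mxE !eqxx scale1r big1 ?addr0 // => k ki.
by rewrite mxE (negPf ki) scale0r.
Qed.

(** The Euler field is the action of [\sum_i x_i y_i] plus a combination of the
    elements [1 - s]: the denominator of the divided difference at s is exactly
    [\sum_i (y_i, alpha_s) x_i]. *)
Lemma eulerE p : euler p =
  \sum_(i < n) 'X_i * dunkl D c (delta_mx 0 i) p
  + \sum_(s in S) (2 * c s / (1 - eigv D s)) *: (p - poly_actW rho s p).
Proof.
rewrite (eq_bigr (fun i => 'X_i * p^`M(i) - \sum_(s in S)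
    (2 * c s / (1 - eigv D s)) *: ((refl_root D s i 0 *: 'X_i) * divdiff D s p))).
  rewrite sumrB exchange_big /= /euler -addrA [X in _ = _ + X](_ : _ = 0) ?addr0 //.
  rewrite addrC -sumrB big1 // => s sS.
  by rewrite -scaler_sumr -mulr_suml -/(linear_form _) divdiffP // subrr.
move=> i _; rewrite dunklE directional_delta mulrBr; congr (_ - _).
rewrite [LHS]mulr_sumr.
apply: eq_bigr => s sS; rewrite -scalerAr -scalerAl scalerA; congr (_ * _ *: _).
by rewrite /pairing -rowE !mxE.
Qed.

Lemma euler_submodule (N : {pred P}) :
  submodule (M := polynomial_module D c) N -> {in N, forall p, euler p \in N}.
Proof.
move=> [NS NW NX NY] p pN; rewrite eulerE.
apply: submod_closed_add => //; apply: submod_closed_sum => //.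
  by move=> i _; rewrite linear_formX; apply: NX; apply: NY.
move=> s sS; apply: submod_closed_scale => //; apply: submod_closed_sub => //.
by apply: NW => //; apply: reflW sS.
Qed.

Lemma homog_component_submodule (N : {pred P}) (p : P) d :
  submodule (M := polynomial_module D c) N -> p \in N ->
  pihomog mdeg d p \in N.
Proof.
move=> Nsub pN; have [NS _ _ _] := Nsub.
(* The bound exceeds d even when the degree of p does not. *)
have := pihomog_partitionE (leq_maxl (msize p) d.+1).
move=> pE; have := @eigen_components F P N euler (maxn (msize p) d.+1)
  (fun k => pihomog mdeg k p) (fun k => k%:R) NS euler_is_linear.
apply => //; last by rewrite leq_maxr.
- exact: euler_submodule.
- by move=> i j /eqP; rewrite eqr_nat => /eqP.
- by move=> k; apply/euler_homog/pihomogP.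
by rewrite -pE.
Qed.

Lemma submodule_const (N : {pred P}) (p : P) :
  submodule (M := polynomial_module D c) N -> p \in N -> p@_0 != 0 -> 1 \in N.
Proof.
move=> Nsub pN p0; have := homog_component_submodule 0 Nsub pN.
have -> : pihomog mdeg 0 p = p@_0 *: 1.
  rewrite pihomogE big_mkcond (bigD1_seq 0%MM) ?mcoeff_msupp ?msupp_uniq //=.
  by rewrite mdeg0 mpolyX0 big1 ?addr0 // => m; rewrite mdeg_eq0 => /negPf ->.
have [NS _ _ _] := Nsub => /(submod_closed_scale NS (p@_0)^-1).
by rewrite scalerA mulVf // scale1r.
Qed.

End Polynomials.

(** * The Laplacian of an invariant form *)

Section InvariantForm.
Variables (F : numFieldType) (gT : finGroupType) (W : {group gT}) (n : nat).
Variables (rho : mx_representation F W n) (D : root_data rho).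
Variable c : invariant_parameter rho.

Local Notation P := {mpoly F[n]}.
Local Notation S := (reflections rho).

Variable B : 'M[F]_n.
Hypotheses (Bsym : B^T = B) (Bunit : B \in unitmx).
Hypothesis Binv : forall g, g \in W -> rho g *m B *m (rho g)^T = B.

Definition flat (y : 'rV[F]_n) : 'cV[F]_n := B *m y^T.
Definition sharp (x : 'cV[F]_n) : 'rV[F]_n := x^T *m invmx B.

Lemma invB_sym : (invmx B)^T = invmx B.
Proof. by rewrite trmx_inv Bsym. Qed.

Lemma sharpK x : flat (sharp x) = x.
Proof. by rewrite /flat /sharp trmx_mul trmxK invB_sym mulKVmx. Qed.

Lemma sharp_eq0 x : sharp x = 0 -> x = 0.
Proof. by move=> x0; rewrite -[x]sharpK x0 /flat trmx0 mulmx0. Qed.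

Lemma flatE y : flat y = \sum_i y 0 i *: col i B.
Proof.
apply/matrixP => i j; rewrite ord1 !mxE summxE; apply: eq_bigr => k _.
by rewrite !mxE mulrC.
Qed.

Lemma sharp_act g x : g \in W -> sharp (act_hdual rho g x) = act_h rho g (sharp x).
Proof.
move=> gW; rewrite /sharp /act_h /act_hdual trmx_mul -!mulmxA; congr (_ *m _).
have E : B *m (rho g)^T = rho (g^-1)%g *m B.
  by rewrite -{2}(Binv gW) !mulmxA -repr_mxM ?groupV // mulVg repr_mx1 mul1mx.
by rewrite -[_ *m invmx B](mulKmx Bunit) (mulmxA B) E mulmxK.
Qed.

(** [sharp alpha] is an eigenvector of s, hence proportional to the coroot and
    not orthogonal to alpha; invariance of its nonzero pairing with alpha gives
    [lambda ^ 2 = 1]. *)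
Lemma eigv_isometry s : s \in S -> eigv D s = -1.
Proof.
move=> sS; have sW := reflW sS; have r0 := root_neq0 D sS.
have [w Hw] := refl_act_h D sS.
set a := refl_root D s in r0 Hw *; set l := eigv D s.
have sa : act_h rho s (sharp a) = l *: sharp a.
  by rewrite -sharp_act // act_root // /sharp linearZ scalemxAl.
have l1 : 1 - l != 0 by rewrite subr_eq0 eq_sym eigv_neq1.
have k0 : pairing (sharp a) a != 0.
  apply: contra r0 => /eqP k0; have := Hw (sharp a).
  rewrite sa k0 scale0r -{1}[sharp a]scale1r -scalerBl => /eqP.
  by rewrite scaler_eq0 (negPf l1) => /eqP/sharp_eq0 ->.
have := pairing_act rho (sharp a) a sW.
rewrite sa act_root // -/a -/l pairingZr /pairing -scalemxAl mxE -/(pairing _ _) mulrA.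
move/eqP; rewrite -subr_eq0 -[X in _ - X]mul1r -mulrBl mulf_eq0 (negPf k0) orbF.
rewrite -expr2 subr_sqr_1 mulf_eq0 -opprB oppr_eq0 (negPf l1) /= addr_eq0.
by move/eqP.
Qed.

(** As the eigenvalue is -1, w is the coroot; invariance of the form expresses it
    as [2 sharp alpha / (alpha, alpha)]. *)
Lemma sharp_root s : s \in S -> exists w,
  (forall y, act_h rho s y = y - pairing y (refl_root D s) *: w) /\
  pairing (sharp (refl_root D s)) (refl_root D s) *: w = 2 *: sharp (refl_root D s).
Proof.
move=> sS; have sW := reflW sS; have [w Hw] := refl_act_h D sS.
exists w; split=> [y|]; first by rewrite -Hw opprB addrC subrK.
rewrite -Hw -sharp_act // act_root // eigv_isometry // scaleN1r.
by rewrite /sharp linearN mulNmx opprK -mulr2n scaler_nat.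
Qed.

Lemma sum_sharp_l x :
  \sum_i pairing (delta_mx 0 i) x *: sharp (delta_mx i 0) = sharp x.
Proof.
rewrite /sharp [in RHS](_ : x = \sum_i x i 0 *: delta_mx i 0).
  rewrite linear_sum mulmx_suml; apply: eq_bigr => i _.
  by rewrite /pairing -rowE mxE linearZ -scalemxAl.
by rewrite {1}[x]matrix_sum_delta; apply: eq_bigr => i _; rewrite big_ord1.
Qed.

Lemma sum_sharp_r x :
  \sum_i pairing (sharp (delta_mx i 0)) x *: delta_mx 0 i = sharp x.
Proof.
rewrite [RHS]matrix_sum_delta big_ord1; apply: eq_bigr => i _; congr (_ *: _).
rewrite /pairing /sharp trmx_delta -rowE.
have -> : x^T *m invmx B = (invmx B *m x)^T by rewrite trmx_mul invB_sym.
by rewrite -row_mul [LHS]mxE [RHS]mxE.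
Qed.

Section Laplacian.
Variable V : cherednik_module D c.

(** The element 1/2 \sum_i y_i y^i, with [y^i] the basis dual to [y_i] for the
    form; no choice of an orthonormal basis is made, as its entries would need
    square roots. *)
Definition laplace (v : V) : V :=
  2^-1 *: \sum_(i < n) opY (delta_mx 0 i) (opY (sharp (delta_mx i 0)) v).

Lemma laplace_linear : linear laplace.
Proof.
move=> a u v; rewrite /laplace !scaler_sumr -big_split; apply: eq_bigr => i _ /=.
by rewrite !opY_linear scalerDr !scalerA mulrC.
Qed.

Lemma opY_sum (I : finType) (k : I -> F) (y : I -> 'rV[F]_n) (v : V) :
  opY (\sum_i k i *: y i) v = \sum_i k i *: opY (y i) v.
Proof.
rewrite (linear_fun_sum (opY_linear_h v)); apply: eq_bigr => i _.
exact: (linear_funZ (opY_linear_h v)).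
Qed.

Lemma laplaceY y v : laplace (opY y v) = opY y (laplace v).
Proof.
have C a b (u : V) : opY a (opY b u) = opY b (opY a u).
  by apply/eqP; rewrite -subr_eq0 opYY.
rewrite /laplace (linear_funZ (opY_linear y)) (linear_fun_sum (opY_linear y)).
congr (_ *: _); apply: eq_bigr => i _.
by rewrite (C _ y) (C _ y).
Qed.

(** The group terms cancel one reflection at a time: moving s to the right
    through the Dunkl operator leaves [y_u s] with
    [u = 2 sharp alpha - (sharp alpha, alpha) w], which is 0 by [sharp_root]. *)
Lemma laplaceX x v : laplace (opX x v) = opX x (laplace v) + opY (sharp x) v.
Proof.
pose k (y : 'rV[F]_n) s := c s * pairing y (refl_root D s) * pairing (refl_coroot D s) x.
have YX y (u : V) : opY y (opX x u) =
    opX x (opY y u) + (pairing y x *: u - \sum_(s in S) k y s *: opW s u).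
  by rewrite -opYX addrC subrK.
pose a i : 'rV[F]_n := delta_mx 0 i; pose b i := sharp (delta_mx i 0).
(* The group terms produced by commuting x through two Dunkl operators. *)
have W0 i : \sum_(s in S) k (a i) s *: opW s (opY (b i) v)
    + \sum_(s in S) k (b i) s *: opY (a i) (opW s v)
   = \sum_(s in S) (c s * pairing (refl_coroot D s) x) *:
      (pairing (a i) (refl_root D s) *: opW s (opY (b i) v) +
       pairing (b i) (refl_root D s) *: opY (a i) (opW s v)).
  rewrite -big_split; apply: eq_bigr => s _ /=.
  by rewrite scalerDr !scalerA /k; congr (_ *: _ + _ *: _); rewrite mulrAC.
have W1 s : s \in S -> \sum_i
   (pairing (a i) (refl_root D s) *: opW s (opY (b i) v) +
       pairing (b i) (refl_root D s) *: opY (a i) (opW s v)) = 0.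
  move=> sS; have sW := reflW sS; have [w [Hw Ew]] := sharp_root sS.
  set r := refl_root D s in Hw Ew *.
  have sY y : opW s (opY y v) = opY y (opW s v) - pairing y r *: opY w (opW s v).
    have /= := opWY sW y (opW s v); rewrite -opWM ?groupV // mulVg opW1 => ->.
    by rewrite Hw addrC -scaleNr opY_linear_h scaleNr addrC.
  under eq_bigr => i _ do rewrite sY scalerBr scalerA addrAC.
  have E3 : \sum_i pairing (b i) r * pairing (a i) r = pairing (sharp r) r.
    rewrite -[sharp r in RHS]sum_sharp_l /pairing mulmx_suml summxE.
    by apply: eq_bigr => i _; rewrite -scalemxAl [RHS]mxE mulrC.
  rewrite sumrB big_split /= -!opY_sum sum_sharp_l sum_sharp_r -scaler_suml.
  under [in X in _ - X]eq_bigr => i _ do rewrite mulrC.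
  by rewrite E3 Ew (linear_funZ (opY_linear_h _)) scaler_nat mulr2n subrr.
have Z i : opY (a i) (opY (b i) (opX x v)) =
   opX x (opY (a i) (opY (b i) v)) + (pairing (a i) x *: opY (b i) v +
     pairing (b i) x *: opY (a i) v)
   - (\sum_(s in S) k (a i) s *: opW s (opY (b i) v)
    + \sum_(s in S) k (b i) s *: opY (a i) (opW s v)).
  have Yl : linear (@opY F gT W n rho D c V (a i)) by exact: opY_linear.
  rewrite YX (linear_funD Yl) YX (linear_funB Yl) (linear_funZ Yl).
  rewrite (linear_fun_sum Yl).
  under [X in _ + (_ - X)]eq_bigr => s _ do rewrite (linear_funZ Yl).
  rewrite opprD !addrA; congr (_ - _); rewrite -!addrA; congr (_ + (_ + _)).
  by rewrite addrC.
rewrite /laplace (eq_bigr _ (fun i _ => Z i)) sumrB big_split /=.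
rewrite (eq_bigr _ (fun i _ => W0 i)) exchange_big /=.
rewrite [X in _ - X]big1 ?subr0 => [|s sS]; last by rewrite -scaler_sumr W1 ?scaler0.
rewrite scalerDr (linear_funZ (opX_linear x)) (linear_fun_sum (opX_linear x)).
congr (_ + _).
rewrite big_split /= -!opY_sum sum_sharp_l sum_sharp_r -mulr2n -scaler_nat scalerA.
by rewrite mulVf ?scale1r // pnatr_eq0.
Qed.

End Laplacian.

(** * The invariant quadratic polynomial *)

Definition quadric : P := 2^-1 *: \sum_(i < n) 'X_i * linear_form (col i B).

Lemma quadric_act g : g \in W -> poly_actW rho g quadric = quadric.
Proof.
move=> gW; rewrite /quadric linearZ /=; congr (_ *: _); rewrite linear_sum /=.
under eq_bigr => i _ do rewrite poly_actWM poly_actWX poly_actW_linear_form.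
rewrite /act_hdual -[in RHS](Binv gW).
under eq_bigr => i _ do rewrite {1}/linear_form mulr_suml.
rewrite exchange_big; apply: eq_bigr => k _ /=.
under eq_bigr => i _ do rewrite mxE -scalerAl scalerAr -linearZ.
rewrite -mulr_sumr -linear_sum; congr (_ * linear_form _).
apply/matrixP => j l; rewrite ord1 [RHS]mxE [RHS]mxE summxE; apply: eq_bigr => i _.
rewrite [LHS]mxE mulrC; congr (_ * _); last by rewrite mxE.
by rewrite !mxE; apply: eq_bigr => m _; rewrite mxE.
Qed.

Lemma directional_quadric y : directional y quadric = linear_form (flat y).
Proof.
rewrite /quadric linearZ /= [directional _ _]linear_sum /=.
have -> : \sum_i directional y ('X_i * linear_form (col i B)) =
    linear_form (flat y) + linear_form (flat y).
  under eq_bigr => i _ do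
    rewrite directionalM {1}linear_formX !directional_linear_form.
  rewrite big_split /=; congr (_ + _).
    rewrite flatE linear_sum; apply: eq_bigr => i _.
    by rewrite mul_mpolyC linearZ /pairing -colE mxE.
  rewrite /linear_form; apply: eq_bigr => i _.
  rewrite mulrC mul_mpolyC; congr (_ *: _).
  by rewrite /pairing /flat -[in RHS]Bsym -trmx_mul colE mulmxA -colE !mxE.
by rewrite -mulr2n -scaler_nat scalerA mulVf ?scale1r // pnatr_eq0.
Qed.

Lemma euler_quadric : euler quadric = 2 *: quadric.
Proof.
rewrite scalerA mulfV ?pnatr_eq0 // scale1r; apply: eq_bigr => i _.
by rewrite -directional_delta directional_quadric /flat trmx_delta -colE.
Qed.

Lemma divdiff_quadric s p : s \in S ->
  divdiff D s (quadric * p) = quadric * divdiff D s p.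
Proof.
move=> sS; apply: divdiff_uniq => //.
by rewrite mulrCA divdiffP // poly_actWM quadric_act ?(reflW sS) // mulrBr.
Qed.

(** Divided differences are linear over invariant polynomials, so on multiples
    of the quadric a Dunkl operator behaves as a derivation. *)
Lemma dunkl_quadric y p :
  dunkl D c y (quadric * p) = quadric * dunkl D c y p + linear_form (flat y) * p.
Proof.
rewrite !dunklE directionalM directional_quadric.
under [in LHS]eq_bigr => s sS do rewrite divdiff_quadric // scalerAr.
rewrite -[in LHS]mulr_sumr mulrBr.
by rewrite -addrA addrC.
Qed.

(** * Finite-dimensional quotients *)

Section Quotient.

Variable J : proper_submodule D c.
Local Notation A := (poly_quotient J).
Local Notation proj := (quotient_proj J).
Local Notation M := (quotient_module J).

Definition quadric_op (u : M) : M := proj quadric * (u : A).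

Lemma quadric_op_linear : linear quadric_op.
Proof. by move=> a u v; rewrite /quadric_op mulrDr scalerAr. Qed.

Lemma quotient_linear : linear (quotient_proj J).
Proof. by move=> a p q; rewrite quotient_projD quotient_projZ. Qed.

Lemma quadric_opX (x : 'cV[F]_n) (u : M) :
  quadric_op (opX x u) = opX x (quadric_op u).
Proof.
rewrite /= -[u]quotient_projK /quadric_op quotient_opXE -!quotient_projM.
by rewrite quotient_opXE /poly_opX mulrCA.
Qed.

Lemma quadric_opY (y : 'rV[F]_n) (u : M) :
  opY y (quadric_op u) = quadric_op (opY y u) + opX (flat y) u.
Proof.
rewrite /= -[u]quotient_projK /quadric_op quotient_opXE quotient_opYE.
by rewrite -!quotient_projM quotient_opYE -quotient_projD dunkl_quadric.
Qed.

(** Some combination of powers of the quadric lies in J; these powers have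
    distinct Euler eigenvalues, so one of them lies in J. *)
Lemma quadric_nilpotent : finite_dimensional A ->
  exists N, forall u, iter N quadric_op u = 0.
Proof.
move=> /(finite_dimensional_dependent (fun j => proj quadric ^+ j))
  [m [k [[i ki] k0]]].
have projX j : proj (quadric ^+ j) = proj quadric ^+ j.
  by elim: j => [|j IH]; rewrite ?expr0 ?quotient_proj1 // !exprS quotient_projM IH.
have Jsub := ideal_ofP J; have [NS _ _ _] := Jsub.
pose v j := (if insub j is Some j' then k j' else 0) *: quadric ^+ j.
have eulerX j : euler (quadric ^+ j) = (j%:R * 2) *: quadric ^+ j.
  elim: j => [|j IH].
    by rewrite expr0 mul0r scale0r (euler_homog (d := 0)) ?scale0r // dhomog1.
  rewrite exprS eulerM euler_quadric IH -scalerAl -scalerAr -scalerDl.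
  by congr (_ *: _); ring.
have vJ : v i \in ideal_of J.
  apply: (eigen_components (v := v) NS (@euler_is_linear F n)
    (euler_submodule Jsub) (mu := fun j => j%:R * 2) _ _ _ (ltn_ord i)).
  - by move=> a b /(mulIf _); rewrite pnatr_eq0 => /(_ isT)/eqP; rewrite eqr_nat => /eqP.
  - by move=> j; rewrite (linear_funZ (@euler_is_linear F n)) eulerX !scalerA mulrC.
  have /quotient_projP : proj (\sum_(j < m) v j) = proj 0.
    rewrite (linear_fun_sum quotient_linear) quotient_proj0 -[RHS]k0.
    by apply: eq_bigr => j _; rewrite quotient_projZ projX valK.
  by rewrite subr0.
exists i => u; have -> : iter i quadric_op u = proj (quadric ^+ i) * u.
  elim: (nat_of_ord i) => [|j IH]; first by rewrite expr0 quotient_proj1 mul1r.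
  by rewrite iterS IH exprS quotient_projM -mulrA.
suff /quotient_projP -> : quadric ^+ i - 0 \in ideal_of J by rewrite quotient_proj0 mul0r.
rewrite subr0; have := submod_closed_scale NS (k i)^-1 vJ.
by rewrite /v valK scalerA mulVf // scale1r.
Qed.

Lemma laplace_proj p : exists q,
  @laplace M (proj p) = proj q /\ (msize q <= (msize p).-1)%N.
Proof.
exists (2^-1 *: \sum_(i < n) dunkl D c (delta_mx 0 i)
  (dunkl D c (sharp (delta_mx i 0)) p)); split.
  rewrite /laplace quotient_projZ (linear_fun_sum quotient_linear).
  by congr (_ *: _); apply: eq_bigr => i _; rewrite /= !quotient_opYE.
apply: leq_trans (msizeZ_le _ _) _; apply: leq_trans (msize_sum _ _ _) _.
apply/bigmax_leqP => i _; apply: leq_trans (msize_dunkl _ _ _ _) _.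
by apply: leq_trans (leq_pred _) _; apply: msize_dunkl.
Qed.

Lemma laplace_nilpotent : finite_dimensional A ->
  exists N, forall u, iter N (@laplace M) u = 0.
Proof.
have small N p : (msize p <= N)%N -> iter N (@laplace M) (proj p) = 0.
  elim: N p => [|N IH] p pN.
    by move: pN; rewrite leqn0 msize_poly_eq0 => /eqP ->; apply: quotient_proj0.
  have [q [E qN]] := laplace_proj p; rewrite iterSr E IH //.
  by apply: leq_trans qN _; case: (msize p) pN.
move=> [m [e spanE]]; exists (\max_j msize (generic_quotient.repr (e j))) => u.
have [a ->] := spanE u; have il := iter_linear _ (@laplace_linear M).
rewrite (linear_fun_sum (il _)) big1 // => j _.
rewrite (linear_funZ (il _)) -[e j]quotient_projK small ?scaler0 //.
exact: (leq_bigmax (F := fun j => msize (generic_quotient.repr (e j)))).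
Qed.

(** Dunkl operators lower degrees, so applying them to v as long as the result
    is nonzero ends at a singular vector. *)
Lemma singular_exists (N : {pred M}) : submodule N ->
  (exists2 v, v \in N & v != 0) ->
  exists v, [/\ v \in N, v != 0 & forall y, opY y v = 0].
Proof.
move=> [_ _ _ NY] [v0].
rewrite -[v0]quotient_projK; move: (generic_quotient.repr v0) => p.
move: {2}(msize p) (leqnn (msize p)) => k.
elim: k p => [|k IH] p pk pN p0.
  case/negP: p0; move: pk; rewrite leqn0 msize_poly_eq0 => /eqP ->.
  by rewrite quotient_proj0.
have [H|/existsNP[y /eqP Hy]] := pselect (forall y, opY y (proj p : M) = 0).
  by exists (proj p).
apply: (IH (dunkl D c y p)).
- by apply: leq_trans (msize_dunkl _ _ _ _) _; case: (msize p) pk.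
- by have := NY y _ pN; rewrite /= quotient_opYE.
by move: Hy; rewrite /= quotient_opYE.
Qed.

Lemma proj_maximal (u : A) : exists k (r : 'I_n -> A),
  u = k *: 1 + \sum_i proj 'X_i * r i.
Proof.
rewrite -[u]quotient_projK; elim/poly_gen_ind: (generic_quotient.repr u).
- exists 1, (fun=> 0); rewrite quotient_proj1 scale1r big1 ?addr0 // => i _.
  by rewrite mulr0.
- move=> p q [k [r Er]] [l [t Et]]; rewrite quotient_projD Er Et.
  exists (k + l), (fun i => r i + t i).
  rewrite scalerDl addrACA -big_split; congr (_ + _).
  by apply: eq_bigr => i _; rewrite mulrDr.
- move=> a p [k [r Er]]; rewrite quotient_projZ Er; exists (a * k), (fun i => a *: r i).
  rewrite scalerDr scalerA scaler_sumr; congr (_ + _).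
  by apply: eq_bigr => i _; rewrite scalerAr.
- move=> i p _; exists 0, (fun j => if j == i then proj p else 0).
  rewrite scale0r add0r (bigD1 i) //= eqxx quotient_projM big1 ?addr0 // => j.
  by move=> /negPf ->; rewrite mulr0.
Qed.

(** The vector 1 is singular, so its Fourier transform spans the socle; that of
    any singular vector is then a multiple of it. *)
Theorem gorenstein_irreducible : finite_dimensional A -> gorenstein A ->
  irreducible_module M.
Proof.
move=> fdA gA.
have [NE eN] := quadric_nilpotent fdA.
have [NF fN] := laplace_nilpotent fdA.
have el := quadric_op_linear; have fl := @laplace_linear M.
pose T (v : M) : M := expo NE quadric_op (expo NF (@laplace M)
   (expo NE quadric_op v)).
have Tl : linear T.
  by move=> a u v; rewrite /T !(expo_linear _ el, expo_linear _ fl).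
have T0 v : T v = 0 -> v = 0.
  by move=> /(expo_inj el eN)/(expo_inj fl fN)/(expo_inj el eN).
have Tsoc v : (forall y, opY y v = 0) -> forall i, proj 'X_i * T v = 0.
  move=> yv i; pose x : 'cV[F]_n := delta_mx i 0.
  have <- : opX x (T v) = proj 'X_i * T v.
    rewrite /= -[T v]quotient_projK quotient_opXE /poly_opX -linear_formX.
    by rewrite quotient_projM.
  apply: (fourier_swap (y := opY (sharp x)) el fl _ _ eN fN) => //.
  - exact: opX_linear.
  - exact: opY_linear.
  - by move=> w; rewrite quadric_opY sharpK.
  - by move=> w; apply: quadric_opX.
  - by move=> w; apply: laplaceX.
  - by move=> w; apply: laplaceY.
have one_sing y : opY y (1 : M) = 0.
  by rewrite /= -quotient_proj1 quotient_opYE dunkl1 quotient_proj0.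
have one0 : (1 : M) != 0 by apply: oner_neq0.
split; first by exists 1.
move=> N Nsub.
have [H|] := pselect (forall v, v \in N -> v = 0).
  by left => v vN; rewrite inE; apply/eqP/H.
move=> /existsNP[v /not_implyP[vN /eqP v0]]; right.
have [w [wN w0 yw]] := singular_exists Nsub (ex_intro2 _ _ v vN v0).
have T1 : T 1 != 0 by apply: contra one0 => /eqP/T0 ->.
have [k Tk] := gorenstein_socle gA proj_maximal T1 (Tsoc _ one_sing) (Tsoc _ yw).
have wk : w = k *: 1.
  apply/eqP; rewrite -subr_eq0; apply/eqP/T0.
  by rewrite (linear_funB Tl) (linear_funZ Tl) Tk subrr.
have k0 : k != 0 by apply: contra w0 => /eqP k0; rewrite wk k0 scale0r.
have [NS _ NX _] := Nsub.
have N1 : (1 : M) \in N.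
  have := submod_closed_scale NS k^-1 wN.
  by rewrite wk scalerA mulVf // scale1r.
move=> u; rewrite inE -[u]quotient_projK.
elim/poly_gen_ind: (generic_quotient.repr u) => [|p q pN qN|a p pN|i p pN].
- by rewrite quotient_proj1.
- by rewrite quotient_projD submod_closed_add.
- by rewrite quotient_projZ submod_closed_scale.
by have := NX (delta_mx i 0) _ pN; rewrite /= quotient_opXE /poly_opX -linear_formX.
Qed.

End Quotient.
End InvariantForm.

(** * Uniqueness of the irreducible quotient *)

Section IrreducibleQuotient.
Variables (F : numFieldType) (gT : finGroupType) (W : {group gT}) (n : nat).
Variables (rho : mx_representation F W n) (D : root_data rho).
Variable c : invariant_parameter rho.

Lemma kernel_submodule (M L : cherednik_module D c) (f : M -> L) :
  cherednik_hom f -> submodule (M := M) [pred v | f v == 0].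
Proof.
move=> [fl fW fX fY]; split.
- split=> [|a u v]; first by rewrite inE linear_fun0.
  by rewrite !inE fl => /eqP -> /eqP ->; rewrite scaler0 addr0.
- move=> g gW v; rewrite !inE fW // => /eqP ->.
  by rewrite (linear_fun0 (opW_linear gW)).
- move=> x v; rewrite !inE fX => /eqP ->.
  by rewrite (linear_fun0 (opX_linear x)).
- move=> y v; rewrite !inE fY => /eqP ->.
  by rewrite (linear_fun0 (opY_linear y)).
Qed.

Lemma image_submodule (M L : cherednik_module D c) (f : M -> L) (N : {pred M}) :
  cherednik_hom f -> submodule N ->
  submodule (M := L) [pred v | `[< exists2 u, u \in N & f u = v >]].
Proof.
move=> [fl fW fX fY] [[N0 NZD] NW NX NY]; split.
- split=> [|a v w]; first by rewrite inE; apply/asboolP; exists 0; rewrite ?linear_fun0.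
  rewrite !inE => /asboolP[u uN <-] /asboolP[u' uN' <-].
  by apply/asboolP; exists (a *: u + u'); rewrite ?NZD ?fl.
- move=> g gW v; rewrite !inE => /asboolP[u uN <-]; apply/asboolP.
  by exists (opW g u); rewrite ?fW ?NW.
- move=> x v; rewrite !inE => /asboolP[u uN <-]; apply/asboolP.
  by exists (opX x u); rewrite ?fX ?NX.
- move=> y v; rewrite !inE => /asboolP[u uN <-]; apply/asboolP.
  by exists (opY y u); rewrite ?fY ?NY.
Qed.

(** The image of J in L is 0 or L.  In the latter case 1 is the sum of an element
    of J and one of the kernel of f; one of the two has a nonzero constant term,
    which would make J or the kernel all of F[h]. *)
Lemma kernel_contains (J : proper_submodule D c) (L : cherednik_module D c)
    (f : polynomial_module D c -> L) :
  irreducible_quotient f -> forall p, p \in ideal_of J -> f p = 0.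
Proof.
move=> [fh fs [[w w0] Lirr]]; have [fl fW fX fY] := fh.
case: (Lirr _ (image_submodule fh (ideal_ofP J))) => [H p pJ|H].
  by apply/eqP; apply: H; rewrite inE; apply/asboolP; exists p.
have := H (f 1); rewrite !inE => /asboolP[p pJ fp].
have p0 : p@_0 = 0.
  apply/eqP; apply: contraT => p0.
  by have := ideal_of_proper J; rewrite (submodule_const (ideal_ofP J) pJ p0).
have K1 : (1 : {mpoly F[n]}) \in [pred v | f v == 0].
  apply: (submodule_const (p := 1 - p) (kernel_submodule fh)).
    by rewrite inE (linear_funB fl) fp subrr.
  by rewrite mcoeffB p0 subr0 mcoeff1 eqxx oner_neq0.
have f0 q : f q = 0.
  elim/poly_gen_ind: q => [|q r fq fr|a q fq|i q fq].
  - by apply/eqP: K1.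
  - by rewrite (linear_funD fl) fq fr addr0.
  - by rewrite (linear_funZ fl) fq scaler0.
  rewrite linear_formX; have := fX (delta_mx i 0) q.
  by rewrite fq (linear_fun0 (opX_linear _)).
by case/negP: w0; have [q <-] := fs w; rewrite f0.
Qed.

Lemma quotient_unique (J : proper_submodule D c) :
  irreducible_module (quotient_module J) ->
  unique_irreducible_quotient
    (M := polynomial_module D c) (L := quotient_module J) (quotient_proj J).
Proof.
move=> irrA; split.
  split=> //; last by move=> u; exists (generic_quotient.repr u); apply: quotient_projK.
  split=> [|g gW p|x p|y p]; first exact: quotient_linear.
  - by rewrite /= quotient_opWE.
  - by rewrite /= quotient_opXE.
  - by rewrite /= quotient_opYE.
move=> L f fq; have [fh fs [[w w0] _]] := fq; have [fl fW fX fY] := fh.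
pose phi (u : quotient_module J) : L := f (generic_quotient.repr (u : poly_quotient J)).
have phiE p : phi (quotient_proj J p) = f p.
  apply/eqP; rewrite -subr_eq0 -(linear_funB fl); apply/eqP.
  apply: (kernel_contains (J := J) fq).
  by apply/quotient_projP; rewrite quotient_projK.
have phih : cherednik_hom phi.
  split=> [a u v|g gW u|x u|y u].
  - rewrite -[u]quotient_projK -[v]quotient_projK -quotient_linear !phiE.
    exact: fl.
  - by rewrite -[u]quotient_projK /= quotient_opWE // !phiE; apply: fW.
  - by rewrite -[u]quotient_projK /= quotient_opXE // !phiE; apply: fX.
  - by rewrite -[u]quotient_projK /= quotient_opYE // !phiE; apply: fY.
exists phi; split=> //; have [phil _ _ _] := phih.
have phi0 u : phi u = 0 -> u = 0.
  case: irrA => _ /(_ _ (kernel_submodule phih))[H u0|H].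
    by apply/eqP; apply: H; rewrite inE u0.
  case/negP: w0; have [p <-] := fs w; rewrite -phiE.
  by have := H (quotient_proj J p); rewrite !inE.
have phis v : exists u, phi u = v.
  by have [p <-] := fs v; exists (quotient_proj J p).
have [g gK] := choice phis.
exists g => [u|v]; last exact: gK.
by apply/eqP; rewrite -subr_eq0; apply/eqP/phi0; rewrite (linear_funB phil) gK subrr.
Qed.

End IrreducibleQuotient.

(** * Real reflection groups *)

(** The average over W of the Gram matrices [rho g *m (rho g)^T]; it is positive
    definite, hence invertible. *)
Lemma real_invariant_form (R : realFieldType) (gT : finGroupType)
    (W : {group gT}) (n : nat) (rho : mx_representation R W n) :
  exists B : 'M[R]_n, [/\ B^T = B, B \in unitmx &
    forall g, g \in W -> rho g *m B *m (rho g)^T = B].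
Proof.
exists (\sum_(g in W) rho g *m (rho g)^T); split.
- by rewrite linear_sum; apply: eq_bigr => g _ /=; rewrite trmx_mul trmxK.
- rewrite -row_free_unit -kermx_eq0; apply/rowV0P => v /sub_kermxP vB.
  have sq (u : 'rV[R]_n) : (u *m u^T) 0 0 = \sum_j u 0 j ^+ 2.
    by rewrite mxE; apply: eq_bigr => j _; rewrite mxE.
  have : \sum_(g in W) ((v *m rho g) *m (v *m rho g)^T) 0 0 = 0.
    transitivity ((v *m (\sum_(g in W) rho g *m (rho g)^T) *m v^T) 0 0).
      rewrite mulmx_sumr mulmx_suml summxE; apply: eq_bigr => g _.
      by rewrite trmx_mul !mulmxA.
    by rewrite vB mul0mx mxE.
  have pos (u : 'rV[R]_n) : 0 <= (u *m u^T) 0 0.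
    by rewrite sq sumr_ge0 // => j _; apply: sqr_ge0.
  move/psumr_eq0P => /(_ (fun g _ => pos _) 1%g (group1 W)).
  rewrite repr_mx1 mulmx1 sq => /psumr_eq0P H; apply/rowP => j; rewrite mxE.
  by apply/eqP; rewrite -sqrf_eq0; apply/eqP/H => // i _; apply: sqr_ge0.
move=> g gW; rewrite mulmx_sumr mulmx_suml.
rewrite [RHS](reindex_inj (mulgI g)) /=.
apply: eq_big => [h|h hW]; first by rewrite groupMl.
by rewrite repr_mxM // trmx_mul !mulmxA.
Qed.

Theorem theorem2p2 (R : realType) (gT : finGroupType) (W : {group gT})
    (n : nat) (rhoR : mx_representation R W n)
    (W_refl : reflection_group rhoR) (W_irr : mx_irreducible rhoR)
    (D : root_data (map_repr (real_complex R) rhoR))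
    (c : invariant_parameter (map_repr (real_complex R) rhoR))
    (J : proper_submodule D c) :
  finite_dimensional (poly_quotient J) -> gorenstein (poly_quotient J) ->
  irreducible_module (quotient_module J) /\
  unique_irreducible_quotient
    (M := polynomial_module D c) (L := quotient_module J) (quotient_proj J).
Proof.
move=> fdA gA.
have [B [Bsym Bunit Binv]] := real_invariant_form rhoR.
have irrA : irreducible_module (quotient_module J).
  apply: (gorenstein_irreducible (B := map_mx (real_complex R) B)) => //.
  - by rewrite map_trmx Bsym.
  - by rewrite map_unitmx.
  - by move=> g gW; rewrite /= map_trmx -!map_mxM Binv.
split; [exact: irrA | exact: quotient_unique irrA].
Qed.
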